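(* Let $p\in[1,\infty]$ and let $H:\ell^p(\mathbb{Z})\to\ell^p(\mathbb{Z})$ be given by $(Hx)_n=x_{n+1}+x_{n-1}+v(n)x_n$, where $v:\mathbb{Z}\to\mathbb{Z}$ is $K$-periodic for some $K\in\mathbb{N}$. Then the following are equivalent: (i) the finite section method for $H$ is applicable; (ii) the monodromy matrix $M(0)$ of $H$ satisfies $|\operatorname{tr}(M(0))|>2$.
   Context: For $E\in\mathbb{R}$, transfer matrices $T(n,E)=\begin{pmatrix}E-v(n)&-1\\1&0\end{pmatrix}$ and monodromy matrix $M(E)=T(K-1,E)\cdots T(1,E)T(0,E)$. Finite section method (FSM): for a bounded operator $A$ on $\ell^p(\mathbb{Z})$ with matrix $(a_{ij})_{i,j\in\mathbb{Z}}$, let $A_n=(a_{ij})_{i,j=-n}^n$; the FSM is applicable if $A$ is invertible, $A_n$ are invertible for all sufficiently large $n$, and their inverses (embedded into two-sided infinite matrices) converge strongly to $A^{-1}$.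
   Formalization: For p = ∞, where strong convergence of the embedded inverses never holds (e.g. v ≡ 3, constant sequence), it is replaced by P-strong convergence: ‖P_k(B_n−B)‖→0 and ‖(B_n−B)P_k‖→0 for every k; ℓ^p(Z) is taken over the real numbers. *)

(* Defs.v *)
From HB Require Import structures.
From mathcomp Require Import all_boot all_order all_algebra.
From mathcomp Require Import all_classical all_reals all_analysis.
Set Implicit Arguments. Unset Strict Implicit. Unset Printing Implicit Defensive.
Import Order.TTheory GRing.Theory Num.Theory.
Import numFieldNormedType.Exports.
Local Open Scope classical_set_scope.
Local Open Scope ring_scope.

Section Defs.
Variable R : realType.

Definition lpnorm (p : \bar R) (x : int -> R) : \bar R :=
  match p with
  | r%:E => poweR (\esum_(k in [set: int]) (`|x k| `^ r)%:E) r^-1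
  | _ => ereal_sup (range (fun k => (`|x k|)%:E))
  end.

Definition in_lp (p : \bar R) (x : int -> R) : Prop := (lpnorm p x < +oo)%E.

Definition schr (v : int -> int) (x : int -> R) : int -> R :=
  fun n => x (n + 1) + x (n - 1) + (v n)%:~R * x n.

Definition schr_entry (v : int -> int) (i j : int) : R :=
  if i == j then (v i)%:~R
  else if (i == j + 1) || (j == i + 1) then 1 else 0.

Definition fsec (v : int -> int) (n : nat) : 'M[R]_(n.*2.+1) :=
  \matrix_(i, j) schr_entry v (i%:Z - n%:Z) (j%:Z - n%:Z).

Definition fsec_inv_op (v : int -> int) (n : nat) (x : int -> R) : int -> R :=
  fun k =>
    if `|k| <= n%:Z then
      \sum_(j < n.*2.+1)
        invmx (fsec v n) (inord (absz (k + n%:Z))) j * x (j%:Z - n%:Z)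
    else 0.

Definition trunc (k : nat) (x : int -> R) : int -> R :=
  fun j => if `|j| <= k%:Z then x j else 0.

Definition lp_inverse (p : \bar R) (A B : (int -> R) -> (int -> R)) : Prop :=
  (forall x, in_lp p x -> in_lp p (A x)) /\
  (forall x, in_lp p x -> in_lp p (B x) /\ A (B x) = x /\ B (A x) = x) /\
  (exists C : R, forall x, in_lp p x -> (lpnorm p (B x) <= C%:E * lpnorm p x)%E).

(* Strong convergence of the embedded finite-section inverses to B on ell^p.
   For p < oo: ||B_n x - B x||_p -> 0 for every x in ell^p.
   For p = oo (where norm-strong convergence of finitely supported
   approximants is impossible) we use the standard P-strong convergence:
   ||P_k (B_n - B)|| -> 0 and ||(B_n - B) P_k|| -> 0 for every k. *)
Definition fsec_inv_converges (p : \bar R) (v : int -> int)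
    (B : (int -> R) -> (int -> R)) : Prop :=
  let D n x := fun j => fsec_inv_op v n x j - B x j in
  if p == +oo%E then
    forall (k : nat) (eps : R), 0 < eps ->
      \forall n \near \oo, forall x, in_lp p x -> (lpnorm p x <= 1)%E ->
        (lpnorm p (trunc k (D n x)) <= eps%:E)%E /\
        (lpnorm p (D n (trunc k x)) <= eps%:E)%E
  else
    forall x, in_lp p x -> (fun n => lpnorm p (D n x)) @ \oo --> 0%E.

Definition FSM_applicable (p : \bar R) (v : int -> int) : Prop :=
  exists B, lp_inverse p (schr v) B /\
    (\forall n \near \oo, fsec v n \in unitmx) /\
    fsec_inv_converges p v B.

Definition transfer (v : int -> int) (n : int) (E : R) : 'M[R]_2 :=
  \matrix_(i < 2, j < 2)
    if i == 0 :> nat then (if j == 0 :> nat then E - (v n)%:~R else -1)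
    else (if j == 0 :> nat then 1 else 0).

Definition monodromy (v : int -> int) (K : nat) (E : R) : 'M[R]_2 :=
  \prod_(i < K) transfer v (K.-1 - i)%N%:Z E.

End Defs.

(* Main.v *)
Require Import Defs.
From HB Require Import structures.
From mathcomp Require Import all_boot all_order all_algebra.
From mathcomp Require Import all_classical all_reals all_analysis.
From mathcomp Require Import zify ring lra.
Import Order.TTheory GRing.Theory Num.Theory.
Import numFieldNormedType.Exports.
Set Implicit Arguments. Unset Strict Implicit. Unset Printing Implicit Defensive.
Local Open Scope classical_set_scope.
Local Open Scope ring_scope.

(* Let t be the trace of the monodromy matrix.  Every solution of H u = 0
   satisfies u(n + 2K) = t u(n + K) - u(n).

   If |t| <= 2, solutions grow at most linearly, so u(n) d^|n| lies in every l^p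
   for d < 1, while H maps it to something of relative size O(1/d - 1); hence H
   has no bounded inverse.

   If |t| > 2, there are solutions phi and psi multiplied by l and 1/l over a
   period, with |l| < 1.  Neither vanishes anywhere: from a zero, the recurrence
   with integer coefficients would make both l and 1/l integers.  So the
   combinations of phi and psi vanishing just outside [-n, n] give an explicit
   inverse of the finite section, whose entries decay like r^|i - j| uniformly in
   n.  Comparing the sections of sizes n <= m through the boundary values just
   outside [-n, n] shows that the section inverses converge entrywise to an
   inverse of H, and the same boundary identity bounds the difference to the limit
   by the tail of the limit. *)

(** * Geometric sums over finite sets of integers *)

Lemma sum_geometric_le (R : realType) (t : R) (m : nat) :
  0 <= t < 1 -> \sum_(0 <= i < m) t ^+ i <= (1 - t)^-1.
Proof.
move=> /andP[t0 t1].
have h : (1 - t) * \sum_(0 <= i < m) t ^+ i = 1 - t ^+ m.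
  elim: m => [|m IH]; first by rewrite big_nil expr0; ring.
  by rewrite big_nat_recr//= mulrDr IH exprS; ring.
rewrite -[leRHS]mul1r ler_pdivlMr ?subr_gt0// mulrC h.
by have := exprn_ge0 m t0; lra.
Qed.

Lemma sum_geometric_uniq_le (R : realType) (t : R) (s : seq nat) :
  0 <= t < 1 -> uniq s -> \sum_(i <- s) t ^+ i <= (1 - t)^-1.
Proof.
move=> t01 us; pose m := (\max_(i <- s) i).+1.
have ltm i : i \in s -> (i < m)%N.
  by move=> si; rewrite ltnS; apply: (@leq_bigmax_seq _ s xpredT (fun i : nat => i)).
have e : perm_eq s [seq i <- iota 0 m | i \in s].
  apply: uniq_perm => //; first by rewrite filter_uniq ?iota_uniq.
  move=> i; rewrite mem_filter mem_iota /= add0n.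
  by case: (boolP (i \in s)) => //= /ltm ->.
rewrite (perm_big _ e) big_filter /=.
apply: le_trans (sum_geometric_le m t01).
rewrite /index_iota subn0 big_mkcond; apply: ler_sum => i _.
by case: ifP => // _; apply: exprn_ge0; case/andP: t01.
Qed.

Lemma sum_geometric_int_le (R : realType) (t : R) (j : int) (s : seq int) :
  0 <= t < 1 -> uniq s -> \sum_(i <- s) t ^+ `|i - j|%N <= 2 / (1 - t).
Proof.
move=> t01 us; rewrite (bigID (fun i => j <= i)) /= mulrDl mul1r.
have half (P : pred int) : {in [pred i | P i] &, injective (fun i : int => `|i - j|%N)} ->
    \sum_(i <- s | P i) t ^+ `|i - j|%N <= (1 - t)^-1.
  move=> inj; rewrite -big_filter -(big_map (fun i : int => `|i - j|%N) xpredT (fun k => t ^+ k)).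
  apply: sum_geometric_uniq_le => //; rewrite map_inj_in_uniq ?filter_uniq//.
  move=> a b; rewrite !mem_filter => /andP[Pa _] /andP[Pb _] e.
  by apply: inj => //; rewrite inE.
by apply: lerD; apply: half => a b; rewrite !inE /=; lia.
Qed.

(** * Norm estimates in l^p *)

Section lp.
Variable R : realType.
Implicit Types (p : \bar R) (x y : int -> R) (t M : R).

Lemma esum_scale_le (T : choiceType) (c : R) (a : T -> \bar R) :
  0 <= c -> (forall i, 0 <= a i)%E ->
  (\esum_(i in [set: T]) (c%:E * a i) <= c%:E * \esum_(i in [set: T]) a i)%E.
Proof.
move=> c0 a0; apply: ge_ereal_sup => _ [A [fA _] <-].
rewrite -ge0_mule_fsumr//; apply: lee_pmul => //.
- by apply: fsume_ge0.
- by apply: esum_ge; exists A.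
Qed.

Lemma lpnorm_ge0 p x : (1 <= p)%E -> (0 <= lpnorm p x)%E.
Proof.
case: p => [r||]// _; first exact: poweR_ge0.
by apply: ereal_sup_ge; exists (`|x 0|)%:E => //; exists 0.
Qed.

Lemma ler_lpnorm p x i : (1 <= p)%E -> (`|x i|%:E <= lpnorm p x)%E.
Proof.
case: p => [r||]//; last first.
  by move=> _; apply: ereal_sup_ubound; exists i.
rewrite lee_fin => r1 /=.
have r0 : 0 < r by lra.
have -> : `|x i|%:E = poweR (`|x i| `^ r)%:E r^-1.
  by rewrite poweR_EFin -powRrM divff ?gt_eqF// powRr1.
apply: gt0_ler_poweR.
- by rewrite invr_ge0 ltW.
- by rewrite in_itv/= leey lee_fin powR_ge0.
- by rewrite in_itv/= leey esum_ge0// => ? _; rewrite lee_fin powR_ge0.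
- by apply: esum_ge; exists [set i]; [split|rewrite fsbig_set1].
Qed.

Lemma in_lp_bounded p x : (1 <= p)%E -> in_lp p x ->
  exists2 m : R, lpnorm p x = m%:E & 0 <= m /\ forall i, `|x i| <= m.
Proof.
move=> p1; rewrite /in_lp => xp.
have n0 := lpnorm_ge0 x p1.
have fn : lpnorm p x \is a fin_num by rewrite ge0_fin_numE.
exists (fine (lpnorm p x)); first by rewrite fineK.
split=> [|i]; first exact: fine_ge0.
by rewrite -lee_fin fineK// ler_lpnorm.
Qed.

(* [|y i|] is at most [M] times the supremum over [j] of [t ^ |i - j| * |x j|];
   for [t < 1] this is stable under limits in [y] and bounds every lp norm of
   [y] by that of [x]. *)
Definition supdom t M x y := forall i s,
  (forall j, t ^+ `|i - j|%N * `|x j| <= s) -> `|y i| <= M * s.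

(** A Schur test. For finite [r], domination is applied with [s] the [r]-th root of the sum over [j]
    of [t ^ |i - j| * |x j| ^ r], which is admissible because [t ^ (k r) <= t ^ k]. Summing over [i]
    and exchanging the sums costs the factor [S = 2 / (1 - t)], whose [r]-th root is at most [S]
    since [S >= 1]. The constant is thus the same for every [p]. *)
Lemma lpnorm_supdom p t M x y : (1 <= p)%E -> 0 <= t < 1 -> 0 <= M ->
  in_lp p x -> supdom t M x y ->
  (lpnorm p y <= (M * (2 / (1 - t)))%:E * lpnorm p x)%E.
Proof.
move=> p1 t01 M0 xp xy.
have /andP[t0 t1] := t01.
pose S := 2 / (1 - t).
have S1 : 1 <= S by rewrite /S ler_pdivlMr; lra.
have [m mE [m0 xm]] := in_lp_bounded p1 xp.
case: p p1 xp mE => [r||]// p1 xp mE; last first.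
  rewrite mE -EFinM; apply: ge_ereal_sup => _ [i _ <-].
  rewrite lee_fin; apply: (@le_trans _ _ (M * m)).
    apply: xy => j; apply: le_trans (xm j).
    by rewrite ler_piMl// exprn_ile1// ltW.
  by rewrite -/S mulrAC ler_peMr// mulr_ge0.
move: p1; rewrite lee_fin => r1; have r0 : 0 < r by lra.
have r00 : r != 0 by rewrite gt_eqF.
pose X := \esum_(k in [set: int]) (`|x k| `^ r)%:E.
have X0 : (0 <= X)%E by apply: esum_ge0 => k _; rewrite lee_fin powR_ge0.
have Xfin : X \is a fin_num.
  by rewrite ge0_fin_numE//; apply: (@lty_poweRy _ _ r^-1); rewrite ?invr_eq0.
pose a i := \esum_(j in [set: int]) (t ^+ `|i - j|%N * `|x j| `^ r)%:E.
have term0 i j : (0 <= (t ^+ `|i - j|%N * `|x j| `^ r)%:E)%E.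
  by rewrite lee_fin mulr_ge0 ?exprn_ge0 ?powR_ge0.
have a0 i : (0 <= a i)%E by apply: esum_ge0.
have afin i : a i \is a fin_num.
  rewrite ge0_fin_numE//; apply: (@le_lt_trans _ _ X); last by rewrite -ge0_fin_numE.
  apply: le_esum => j _; rewrite lee_fin ler_piMl ?powR_ge0//.
  by rewrite exprn_ile1// ltW.
have ya i : ((`|y i| `^ r)%:E <= (M `^ r)%:E * a i)%E.
  rewrite -[a i]fineK// -EFinM lee_fin.
  have fa0 : 0 <= fine (a i) by exact: fine_ge0.
  have : `|y i| <= M * fine (a i) `^ r^-1.
    apply: xy => j.
    have -> : t ^+ `|i - j|%N * `|x j| = ((t ^+ `|i - j|%N * `|x j|) `^ r) `^ r^-1.
      by rewrite -powRrM divff// powRr1// mulr_ge0 ?exprn_ge0.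
    apply: ge0_ler_powR; rewrite ?nnegrE ?powR_ge0//.
      by rewrite invr_ge0 ltW.
    rewrite powRM ?exprn_ge0//.
    apply: (@le_trans _ _ (t ^+ `|i - j|%N * `|x j| `^ r)).
      apply: ler_wpM2r; first exact: powR_ge0.
      have [->|tk0] := eqVneq (t ^+ `|i - j|%N) 0; first by rewrite powR0.
      rewrite -[leRHS]powRr1 ?exprn_ge0//; apply: ger_powR => //.
      by rewrite lt_neqAle eq_sym tk0 exprn_ge0//= exprn_ile1// ltW.
    rewrite -lee_fin fineK//; apply: esum_ge; exists [set j] => //.
    by rewrite fsbig_set1.
  move=> /(ge0_ler_powR (ltW r0)); rewrite !nnegrE => /(_ _ _)/le_trans; apply => //.
    by rewrite mulr_ge0 ?powR_ge0.
  by rewrite powRM ?powR_ge0// -powRrM mulVf// powRr1.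
have Y : (\esum_(k in [set: int]) (`|y k| `^ r)%:E <= (M `^ r * S)%:E * X)%E.
  apply: ge_ereal_sup => _ [A [fA _] <-].
  rewrite fsbig_finite//=.
  apply: le_trans (lee_sum _ (fun i _ => ya i)) _.
  rewrite -ge0_sume_distrr// EFinM -muleA.
  apply: lee_wpmul2l; first by rewrite lee_fin powR_ge0.
  rewrite /a -esum_sum//.
  have S0 : 0 <= S by rewrite (le_trans _ S1).
  apply: le_trans (@esum_scale_le _ S (fun k => (`|x k| `^ r)%:E) S0 _); last first.
    by move=> k; rewrite lee_fin powR_ge0.
  apply: le_esum => j _; rewrite sumEFin -EFinM lee_fin -mulr_suml.
  apply: ler_wpM2r; first exact: powR_ge0.
  by apply: sum_geometric_int_le => //; exact: finmap.fset_uniq.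
rewrite /= -/X -/S.
have fP (z : \bar R) : (0 <= z)%E -> z \in `[0%E, +oo%E].
  by move=> z0; rewrite in_itv /= z0 leey.
have Mr0 : (0 <= (M `^ r * S)%:E)%E.
  by rewrite lee_fin mulr_ge0 ?powR_ge0// (le_trans _ S1).
have ri0 : 0 <= r^-1 by rewrite invr_ge0 ltW.
apply: (@le_trans _ _ (poweR ((M `^ r * S)%:E * X) r^-1)).
  apply: gt0_ler_poweR => //; apply: fP; last exact: mule_ge0.
  by apply: esum_ge0 => k _; rewrite lee_fin powR_ge0.
rewrite poweRM//; apply: lee_wpmul2r; first exact: poweR_ge0.
rewrite poweR_EFin lee_fin powRM ?powR_ge0// -?powRrM ?divff// ?powRr1//.
  by apply: ler_wpM2l => //; apply: ler1_powR => //; rewrite invf_le1.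
by rewrite (le_trans _ S1).
Qed.

Lemma in_lp_supdom p t M x y : (1 <= p)%E -> 0 <= t < 1 -> 0 <= M ->
  in_lp p x -> supdom t M x y -> in_lp p y.
Proof.
move=> p1 t01 M0 xp xy; rewrite /in_lp.
apply: le_lt_trans (lpnorm_supdom p1 t01 M0 xp xy) _.
have [m -> _] := in_lp_bounded p1 xp.
by rewrite -EFinM ltry.
Qed.

Lemma in_lp_delta p : (1 <= p)%E -> in_lp p (fun i => (i == 0)%:R).
Proof.
case: p => [r||]//; last first.
  move=> _; apply: (@le_lt_trans _ _ 1%E); last exact: ltry.
  by apply: ge_ereal_sup => _ [i _ <-]; rewrite lee_fin; case: eqP; rewrite /= ?normr1 ?normr0.
rewrite lee_fin => r1; apply: poweR_lty.
apply: (@le_lt_trans _ _ (\esum_(k in [set (0 : int)]) 1%:E)); last first.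
  by rewrite esum_set1 ?ltry// lee_fin.
rewrite [leRHS]esum_mkcond; apply: le_esum => i _.
case: eqP => [->|_]; first by rewrite normr1 powR1 mem_set.
rewrite normr0 powR0; last by rewrite gt_eqF//; lra.
by case: ifP; rewrite lee_fin.
Qed.

(** The bound says that [y] is dominated by the unit sequence at 0, which settles all [p] at
    once. *)
Lemma in_lp_geometric p t M y : (1 <= p)%E -> 0 <= t < 1 -> 0 <= M ->
  (forall i, `|y i| <= M * t ^+ `|i|%N) -> in_lp p y.
Proof.
move=> p1 t01 M0 yM; apply: (in_lp_supdom p1 t01 M0 (in_lp_delta p1)).
move=> i s /(_ 0); rewrite subr0 eqxx normr1 mulr1 => ts.
by apply: le_trans (yM i) _; rewrite ler_wpM2l.
Qed.

Lemma cvge0_near_le (f : nat -> \bar R) : (forall n, 0 <= f n)%E ->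
  (forall e : R, 0 < e -> \forall n \near \oo, (f n <= e%:E)%E) ->
  f @ \oo --> 0%E.
Proof.
move=> f0 fe; apply/fine_cvgP; split.
  apply: filterS (fe 1 ltr01) => n fn.
  by rewrite ge0_fin_numE//; apply: le_lt_trans fn (ltry _).
apply/cvgrPdist_le => e /fe; apply: filterS => n fn /=.
have ffin : f n \is a fin_num.
  by rewrite ge0_fin_numE//; apply: le_lt_trans fn (ltry _).
by rewrite sub0r normrN ger0_norm ?fine_ge0// -lee_fin fineK.
Qed.

Lemma finite_set_int_bounded (A : set int) : finite_set A ->
  exists N : nat, forall i, A i -> `|i| <= N%:Z.
Proof.
move=> fA; pose s := finmap.enum_fset (fset_set A).
exists (\max_(i <- s) `|i|%N)%N => i Ai.
have : i \in s by rewrite /s in_fset_set// inE.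
move=> /(@leq_bigmax_seq _ s xpredT (fun i : int => `|i|%N)) /(_ isT) /=; by rewrite -abszE lez_nat.
Qed.

(** A finite set [A] carries the sum of [|x k| ^ r] up to [e ^ r]. Once the box contains [A], the
    tail [b] and the part [c] on [A] have disjoint supports, so the tail sums to at most [e ^ r]. *)
Lemma lpnorm_tail_cvg0 (r : R) x : 1 <= r -> in_lp r%:E x ->
  (fun n : nat => lpnorm r%:E (fun j => if `|j| <= n%:Z then 0 else x j)) @ \oo --> 0%E.
Proof.
move=> r1 xp; have r0 : 0 < r by lra.
have r00 : r != 0 by rewrite gt_eqF.
apply: cvge0_near_le => [n|e e0]; first exact: poweR_ge0.
pose a k := (`|x k| `^ r)%:E; pose X := \esum_(k in [set: int]) a k.
have a0 k : (0 <= a k)%E by rewrite lee_fin powR_ge0.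
have X0 : (0 <= X)%E by apply: esum_ge0.
have Xfin : X \is a fin_num.
  by rewrite ge0_fin_numE//; apply: (@lty_poweRy _ _ r^-1); rewrite ?invr_eq0.
have er0 : 0 < e `^ r by exact: powR_gt0.
have [_ [A [fA _] <-] AX] := ub_ereal_sup_adherent er0 Xfin.
have [N AN] := finite_set_int_bounded fA.
near=> n.
have An : A `<=` [set i | `|i| <= n%:Z].
  move=> i /AN /le_trans; apply.
  by rewrite lez_nat; near: n; exact: nbhs_infty_ge.
pose b k := if `|k| <= n%:Z then 0%E else a k.
have b0 k : (0 <= b k)%E by rewrite /b; case: ifP.
have bE : lpnorm r%:E (fun j => if `|j| <= n%:Z then 0 else x j) =
          poweR (\esum_(k in [set: int]) b k) r^-1.
  rewrite /lpnorm; congr poweR; apply: eq_esum => k _; rewrite /b.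
  by case: ifP; rewrite ?normr0 ?powR0.
pose c k := if k \in A then a k else 0%E.
have c0 k : (0 <= c k)%E by rewrite /c; case: ifP.
have bcX : (\esum_(k in [set: int]) b k + \esum_(k in [set: int]) c k <= X)%E.
  rewrite -esumD//; apply: le_esum => k _; rewrite /b /c.
  case: ifPn => [_|kn]; first by rewrite add0e; case: ifP.
  case: ifPn => [kA|_]; last by rewrite adde0.
  by move: kA; rewrite inE => /An /=; rewrite (negbTE kn).
have cE : \esum_(k in [set: int]) c k = (\sum_(k \in A) a k)%E.
  by rewrite -esum_mkcond esum_fset.
have be : (\esum_(k in [set: int]) b k <= (e `^ r)%:E)%E.
  move: AX; rewrite -/X => AX; move: bcX; rewrite cE => bcX.
  have cfin : (\sum_(k \in A) a k)%E \is a fin_num.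
    rewrite ge0_fin_numE; last by rewrite -cE esum_ge0.
    apply: le_lt_trans (_ : (_ <= X)%E) _; last by rewrite -ge0_fin_numE.
    by rewrite -cE; apply: le_trans bcX; rewrite -cE leeDr// esum_ge0.
  move: AX; rewrite lteBlDr// => AX.
  by have := le_lt_trans bcX AX; rewrite addeC lteD2lE// => /ltW.
rewrite bE.
have -> : e%:E = poweR (e `^ r)%:E r^-1.
  by rewrite poweR_EFin -powRrM divff// powRr1// ltW.
apply: gt0_ler_poweR => //.
- by rewrite invr_ge0 ltW.
- by rewrite in_itv/= leey esum_ge0.
- by rewrite in_itv/= leey lee_fin powR_ge0.
Unshelve. all: end_near.
Qed.

End lp.

(** * Solutions of the recurrence and the trace of the monodromy matrix *)

Lemma int_shift_ind (P : int -> Prop) (m : int) : P m ->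
  (forall k, P k -> P (k + 1)) -> (forall k, P k -> P (k - 1)) -> forall k, P k.
Proof.
move=> Pm Pp Pn k; have -> : k = m + (k - m) by ring.
elim/int_rect: (k - m) => [|n IH|n IH]; first by rewrite addr0.
- have -> : m + n.+1%:Z = (m + n%:Z) + 1 by lia.
  exact: Pp.
- have -> : m - n.+1%:Z = (m - n%:Z) - 1 by lia.
  exact: Pn.
Qed.

Section solutions.
Variables (R : realType) (v : int -> int).
Implicit Types (u w : int -> R).

Definition is_sol u := forall n, schr v u n = 0.

Lemma sol_next u n : is_sol u -> u (n + 1) = - u (n - 1) - (v n)%:~R * u n.
Proof. by move=> /(_ n); rewrite /schr => h; lra. Qed.

Lemma sol_prev u n : is_sol u -> u (n - 1) = - u (n + 1) - (v n)%:~R * u n.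
Proof. by move=> /(_ n); rewrite /schr => h; lra. Qed.

Lemma sol_lin (a b : R) u w : is_sol u -> is_sol w ->
  is_sol (fun n => a * u n + b * w n).
Proof.
move=> su sw n; rewrite /schr (sol_next n su) (sol_next n sw); ring.
Qed.

(** The recurrence has integer coefficients and can be solved for either neighbour with coefficient
    -1, so integrality spreads in both directions. With [c = 0] this gives uniqueness of solutions;
    with [c] a nonzero value it later rules out zeros of eigensolutions. *)
Lemma sol_int_multiple u m (c : R) : is_sol u ->
  (exists z : int, u m = z%:~R * c) -> (exists z : int, u (m + 1) = z%:~R * c) ->
  forall k, exists z : int, u k = z%:~R * c.
Proof.
move=> su um um1 k.
suff [] : (exists z : int, u k = z%:~R * c) /\ (exists z : int, u (k + 1) = z%:~R * c) by [].
move: k; apply: (@int_shift_ind _ m) => // k [[z zk] [z' zk']]; split.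
- by exists z'.
- exists (- z - v (k + 1) * z'); rewrite (sol_next (k + 1) su) addrK zk zk'.
  by rewrite rmorphB rmorphN rmorphM /=; ring.
- exists (- z' - v k * z); rewrite (sol_prev k su) zk zk'.
  by rewrite rmorphB rmorphN rmorphM /=; ring.
- by rewrite subrK; exists z.
Qed.

Lemma sol_eq0 u m : is_sol u -> u m = 0 -> u (m + 1) = 0 -> forall k, u k = 0.
Proof.
move=> su um um1 k.
have [||z ->] := sol_int_multiple (m := m) (c := 0) su _ _ k; last by rewrite mulr0.
- by exists 0; rewrite mulr0.
- by exists 0; rewrite mulr0.
Qed.

Lemma sol_uniq u w m : is_sol u -> is_sol w ->
  u m = w m -> u (m + 1) = w (m + 1) -> forall k, u k = w k.
Proof.
move=> su sw um um1 k.
have := @sol_eq0 _ m (sol_lin 1 (-1) su sw).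
rewrite um um1 => /(_ _ _ k) h; apply/eqP; rewrite -subr_eq0; apply/eqP.
by rewrite -h; ring.
Qed.

(** For the solution [u] with [u 0 = a] and [u (-1) = b], [sol_fwd] carries the pair
    [(u n, u (n - 1))] and [sol_bwd] the pair [(u (- n), u (- n - 1))]. As [Negz n] is [- n - 1],
    negative arguments read off the second component. *)
Fixpoint sol_fwd (a b : R) (n : nat) : R * R :=
  if n is n'.+1 then let p := sol_fwd a b n' in (- (v n'%:Z)%:~R * p.1 - p.2, p.1)
  else (a, b).

Fixpoint sol_bwd (a b : R) (n : nat) : R * R :=
  if n is n'.+1 then
    let p := sol_bwd a b n' in (p.2, - (v (- n.+1%:Z + 1))%:~R * p.2 - p.1)
  else (a, b).

(* The solution with value [a] at 0 and [b] at -1. *)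
Definition sol_of (a b : R) (z : int) : R :=
  match z with Posz n => (sol_fwd a b n).1 | Negz n => (sol_bwd a b n).2 end.

Lemma sol_ofP a b : is_sol (sol_of a b).
Proof.
move=> [[|n]|[|n]]; rewrite /schr.
- by rewrite add0r sub0r /=; ring.
- have -> : Posz n.+1 + 1 = Posz n.+2 by lia.
  have -> : Posz n.+1 - 1 = Posz n by lia.
  by rewrite /=; ring.
- have -> : Negz 0 + 1 = Posz 0 by lia.
  have -> : Negz 0 - 1 = Negz 1 by lia.
  have e : - (2%:Z) + 1 = Negz 0 by lia.
  by rewrite /= e; ring.
- have -> : Negz n.+1 + 1 = Negz n by lia.
  have -> : Negz n.+1 - 1 = Negz n.+2 by lia.
  have e : - (n.+3%:Z) + 1 = Negz n.+1 by lia.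
  by rewrite /= e; ring.
Qed.

(** The Casoratian, or discrete Wronskian, is constant because the two neighbours enter the
    recurrence with equal coefficients. *)
Lemma casorati_const u w : is_sol u -> is_sol w -> forall n,
  u n * w (n + 1) - u (n + 1) * w n = u 0 * w 1 - u 1 * w 0.
Proof.
move=> su sw; apply: (@int_shift_ind _ 0) => [|k IH|k IH].
- by rewrite add0r.
- rewrite -IH (sol_next (k + 1) su) (sol_next (k + 1) sw) addrK; ring.
- by rewrite -IH subrK (sol_prev k su) (sol_prev k sw); ring.
Qed.

Variables (K : nat).
Hypothesis (vK : forall n, v (n + K%:Z) = v n).

Lemma sol_shift u : is_sol u -> is_sol (fun n => u (n + K%:Z)).
Proof.
move=> su n; have := su (n + K%:Z); rewrite /schr vK.
by rewrite (addrAC n 1) (addrAC n (-1)).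
Qed.

Definition state u (n : int) : 'cV[R]_2 := \col_(i < 2) (if i == 0 :> nat then u n else u (n - 1)).

Lemma transfer_state u n : is_sol u -> transfer v n 0 *m state u n = state u (n + 1).
Proof.
move=> su; apply/colP => i; rewrite !mxE !big_ord_recl big_ord0 !mxE /=.
case: i => [[|[|//]] ?] /=; last by rewrite addrK; ring.
by rewrite (sol_next n su); ring.
Qed.

Lemma monodromy_state u : is_sol u -> monodromy v K 0 *m state u 0 = state u K%:Z.
Proof.
move=> su; rewrite /monodromy; elim: K => [|k IH].
  by rewrite big_ord0 mul1mx.
rewrite big_ord_recl /= subn0.
rewrite -mulmxA.
rewrite (eq_bigr (fun i : 'I_k => transfer v (k.-1 - i)%N%:Z 0)); last first.
  by move=> i _; congr (transfer _ (Posz _) _); rewrite /bump /=; case: i => i /=; lia.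
by rewrite IH transfer_state// intS addrC.
Qed.

(** The columns of the monodromy matrix are the states at [K] of the two solutions with unit states
    at 0. *)
Lemma trace_monodromy :
  \tr (@monodromy R v K 0) = sol_of 1 0 K%:Z + sol_of 0 1 (K%:Z - 1).
Proof.
have h a b := monodromy_state (sol_ofP a b).
rewrite /mxtrace !big_ord_recl big_ord0 addr0; congr (_ + _).
- have /colP/(_ ord0) := h 1 0; rewrite !mxE !big_ord_recl big_ord0 !mxE /= => <-.
  by rewrite mulr1 mulr0 !addr0.
- have /colP/(_ (lift ord0 ord0)) := h 0 1; rewrite !mxE !big_ord_recl big_ord0 !mxE /= => <-.
  by rewrite mulr1 mulr0 addr0 add0r.
Qed.

(** Cayley-Hamilton for the monodromy matrix, written in the basis [u0], [u1]; its determinant is a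
    Casoratian and equals 1. Both sides are solutions in [n], so comparing them at -1 and 0 is
    enough. *)
Lemma sol_trace u n : is_sol u ->
  u (n + K%:Z + K%:Z) = \tr (@monodromy R v K 0) * u (n + K%:Z) - u n.
Proof.
move=> su.
pose T := \tr (@monodromy R v K 0).
pose u0 := sol_of 1 0; pose u1 := sol_of 0 1.
have s0 : is_sol u0 := sol_ofP _ _. have s1 : is_sol u1 := sol_ofP _ _.
have decomp w k : is_sol w -> w k = w 0 * u0 k + w (-1) * u1 k.
  move=> sw; apply: (@sol_uniq _ _ (-1) sw (sol_lin _ _ s0 s1)).
  - by rewrite /u0 /u1 /=; ring.
  - by rewrite addNr /u0 /u1 /=; ring.
have det1 : u0 K%:Z * u1 (K%:Z - 1) - u0 (K%:Z - 1) * u1 K%:Z = 1.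
  have := casorati_const s0 s1 (K%:Z - 1); rewrite subrK.
  have := casorati_const s0 s1 (-1); rewrite addNr.
  rewrite /u0 /u1 /= => h1 h2; lra.
have TE : T = u0 K%:Z + u1 (K%:Z - 1) by rewrite /T trace_monodromy.
(* The solution shifted by [K] has the values [w K] and [w (K - 1)] at 0 and -1, which are its
   coordinates in the basis. *)
have rec0 w : is_sol w -> w (K%:Z + K%:Z) = T * w K%:Z - w 0.
  move=> sw; have := decomp _ K%:Z (sol_shift sw); rewrite add0r (addrC (-1)) => ->.
  rewrite TE (decomp _ K%:Z sw) (decomp _ (K%:Z - 1) sw).
  apply/eqP; rewrite -subr_eq0; apply/eqP.
  transitivity (w 0 * (1 - (u0 K%:Z * u1 (K%:Z - 1) - u0 (K%:Z - 1) * u1 K%:Z))).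
    by ring.
  by rewrite det1; ring.
have recN1 w : is_sol w -> w (-1 + K%:Z + K%:Z) = T * w (-1 + K%:Z) - w (-1).
  move=> sw; have := decomp _ (-1 + K%:Z) (sol_shift sw).
  rewrite add0r (addrC (-1)) => ->.
  rewrite TE (decomp _ K%:Z sw) (decomp _ (K%:Z - 1) sw).
  apply/eqP; rewrite -subr_eq0; apply/eqP.
  transitivity (w (-1) * (1 - (u0 K%:Z * u1 (K%:Z - 1) - u0 (K%:Z - 1) * u1 K%:Z))).
    by ring.
  by rewrite det1; ring.
have sR := sol_lin T (-1) (sol_shift su) su.
rewrite (@sol_uniq _ _ (-1) (sol_shift (sol_shift su)) sR) /=.
- by rewrite -/T; ring.
- by rewrite recN1//; ring.
- by rewrite addNr !add0r rec0//; ring.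
Qed.

End solutions.

(** * Eigensolutions of the shift by one period when the trace exceeds 2 in modulus *)

Lemma hyperbolic_roots (R : realType) (t : R) : 2 < `|t| ->
  exists l m : R, [/\ l + m = t, l * m = 1 & `|l| < 1].
Proof.
move=> t2.
have ht2 : 4 < t ^+ 2 by rewrite -real_normK ?num_real//; nra.
pose d := Num.sqrt (t ^+ 2 - 4).
have d0 : 0 < d by rewrite sqrtr_gt0; lra.
have dE : d ^+ 2 = t ^+ 2 - 4 by rewrite sqr_sqrtr//; lra.
(* The roots of [X ^ 2 - t X + 1] are [(t - d) / 2] and [(t + d) / 2]; the sign of [t] decides which
   one lies inside the unit disc. *)
have [tp|tn] := ltP 0 t.
- move: t2; rewrite gtr0_norm// => t2.
  exists ((t - d) / 2), ((t + d) / 2); split; first by lra.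
  - by rewrite mulrACA -subr_sqr dE; field.
  - by rewrite ltr_norml; apply/andP; split; nra.
- move: t2; rewrite ler0_norm// => t2.
  exists ((t + d) / 2), ((t - d) / 2); split; first by lra.
  - by rewrite mulrACA (mulrC (t + d)) -subr_sqr dE; field.
  - by rewrite ltr_norml; apply/andP; split; nra.
Qed.

Lemma periodic_bounded (R : realType) (K : nat) (h : int -> R) : (0 < K)%N ->
  (forall n, h (n + K%:Z) = h n) -> exists2 C : R, 0 < C & forall n, `|h n| <= C.
Proof.
move=> K0 hK.
have hmul n (q : int) : h (n + q * K%:Z) = h n.
  elim/int_rect: q => [|q IH|q IH]; first by rewrite mul0r addr0.
  - by rewrite intS mulrDl mul1r addrA addrAC hK.
  - rewrite -[LHS]hK -IH; congr h; lia.
exists (1 + \sum_(i < K) `|h i%:Z|) => [|n].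
  by apply: ltr_pwDl => //; apply: sumr_ge0.
have Kz : K%:Z != 0 by lia.
have rlt : (`|(n %% K%:Z)%Z| < K)%N.
  by have := modz_ge0 n Kz; have := ltz_pmod n (d := K%:Z); lia.
have -> : h n = h (Ordinal rlt : nat)%:Z.
  rewrite /= gez0_abs ?modz_ge0//.
  by rewrite [in LHS](divz_eq n K%:Z) addrC hmul.
rewrite (bigD1 (Ordinal rlt))//= addrCA lerDl addr_ge0// sumr_ge0//.
Qed.

(** [|phi n| * r ^ (- n)] is [K]-periodic and never zero, hence bounded above and away from 0. The
    two bounds [C] and [D] multiply to the constant. *)
Lemma quasi_periodic_compare (R : realType) (K : nat) (l r : R) (phi : int -> R) :
  (0 < K)%N -> 0 < r -> r ^+ K = `|l| -> (forall n, phi n != 0) ->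
  (forall n, phi (n + K%:Z) = l * phi n) ->
  exists2 C : R, 0 < C & forall i j, `|phi j| <= C * r ^ (j - i) * `|phi i|.
Proof.
move=> K0 r0 rK nz phiK.
have rn0 : r != 0 by rewrite gt_eqF.
have rp (k : int) : 0 < r ^ k by rewrite exprz_gt0.
pose h n := `|phi n| * r ^ (- n).
have hK n : h (n + K%:Z) = h n.
  rewrite /h phiK normrM opprD expfzDr// -rK.
  have -> : r ^ (- K%:Z) = (r ^+ K)^-1 by rewrite -invr_expz.
  have : r ^+ K != 0 by rewrite expf_neq0.
  by move=> ?; field.
have h0 n : 0 < h n by rewrite /h mulr_gt0// normr_gt0.
have [C C0 hC] := periodic_bounded K0 hK.
have hKi n : (h (n + K%:Z))^-1 = (h n)^-1 by rewrite hK.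
have [D D0 hD] := periodic_bounded K0 hKi.
exists (C * D) => [|i j]; first exact: mulr_gt0.
have phiE n : `|phi n| = h n * r ^ n.
  by rewrite /h -mulrA -expfzDr// addNr expr0z mulr1.
rewrite !phiE expfzDr//.
have -> : C * D * (r ^ j * r ^ (- i)) * (h i * r ^ i) =
    C * (D * h i) * r ^ j * (r ^ (- i) * r ^ i) by ring.
rewrite -expfzDr// addNr expr0z mulr1; apply: ler_wpM2r; first exact: ltW.
apply: (@le_trans _ _ C); first by have := hC j; rewrite gtr0_norm.
apply: ler_peMr; first exact: ltW.
have := hD i; rewrite gtr0_norm ?invr_gt0// => hi.
by rewrite -(mulVf (lt0r_neq0 (h0 i))) ler_wpM2r// ltW.
Qed.

Section eigensolutions.
Variables (R : realType) (v : int -> int) (K : nat).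
Hypothesis (vK : forall n, v (n + K%:Z) = v n).
Local Notation T := (\tr (@monodromy R v K 0)).

(** With [S] the shift by [K], [(S - l) (S - m) = 0] on solutions, so [S - m] maps solutions to
    eigensolutions for [l]. If it annihilated both basis solutions, the trace would be [2 m],
    forcing [l = m]. *)
Lemma eigen_sol (l m : R) : l + m = T -> l * m = 1 -> l != m ->
  exists phi : int -> R, [/\ is_sol v phi,
    forall n, phi (n + K%:Z) = l * phi n & exists n, phi n != 0].
Proof.
move=> lmT lm1 lm.
have key u : is_sol v u -> let phi := (fun n => 1 * u (n + K%:Z) + (- m) * u n) in
    is_sol v phi /\ forall n, phi (n + K%:Z) = l * phi n.
  move=> su phi; split; first exact: sol_lin (sol_shift vK su) su.
  move=> n; rewrite /phi (sol_trace vK n su) -lmT.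
  have -> : u n = l * m * u n by rewrite lm1 mul1r.
  by ring: lm1.
have [s0 q0] := key _ (sol_ofP v 1 0); have [s1 q1] := key _ (sol_ofP v 0 1).
have [h0|/forallNP h0] := pselect (exists n,
    1 * sol_of v 1 0 (n + K%:Z) + (- m) * sol_of v 1 0 n != 0).
  by eexists; split; [exact: s0|exact: q0|].
have [h1|/forallNP h1] := pselect (exists n,
    1 * sol_of v 0 1 (n + K%:Z) + (- m) * sol_of v 0 1 n != 0).
  by eexists; split; [exact: s1|exact: q1|].
exfalso; move: lm; apply/negP; rewrite negbK; apply/eqP.
have := h0 0; have := h1 (-1).
rewrite add0r (addrC (-1)) => /negP; rewrite negbK => /eqP e1 /negP; rewrite negbK => /eqP e0.
move: lmT; rewrite trace_monodromy.
have a0 : sol_of v 1 0 0 = 1 :> R by [].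
have b0 : sol_of v 0 1 (-1) = 1 :> R by [].
by move: e0 e1; rewrite a0 b0; lra.
Qed.

(* If [phi n = 0], all values of [phi] are integer multiples of [phi (n + 1)]. *)
Lemma eigen_sol_neq0 (l m : R) (phi : int -> R) : is_sol v phi ->
  (forall n, phi (n + K%:Z) = l * phi n) -> l * m = 1 -> `|l| != 1 ->
  (exists n, phi n != 0) -> forall n, phi n != 0.
Proof.
move=> s q lm1 l1 [n0 nz] n; apply/negP => /eqP pn.
pose c := phi (n + 1).
have c0 : c != 0.
  by apply/negP => /eqP c0; move: nz; rewrite (sol_eq0 s pn c0) eqxx.
have mult := @sol_int_multiple _ _ _ n c s.
have [||z zE] := mult _ _ (n + 1 + K%:Z); first by exists 0; rewrite mul0r.
  by exists 1; rewrite mul1r.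
have [||z' zE'] := mult _ _ (n + 1 - K%:Z); first by exists 0; rewrite mul0r.
  by exists 1; rewrite mul1r.
have lz : l = z%:~R by apply: (mulIf c0); rewrite -zE q.
have mz : m = z'%:~R.
  apply: (mulIf c0); rewrite -zE' /c.
  have := q (n + 1 - K%:Z); rewrite subrK => ->.
  by rewrite mulrA (mulrC m) lm1 mul1r.
move: lm1; rewrite lz mz -intrM => /eqP; rewrite -[1]/(1%:~R) eqr_int => /eqP zz.
move: l1; rewrite lz -intr_norm.
have : `|z| = 1.
  by have := congr1 absz zz; rewrite abszM => /eqP; rewrite muln_eq1 => /andP[/eqP ? _]; lia.
by move=> ->; rewrite eqxx.
Qed.

End eigensolutions.

(** * Finite sections and their Green kernels *)

Section box.
Variables (R : realType) (v : int -> int).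

Lemma sum_box n (f : int -> R) (z : int) :
  \sum_(j < n.*2.+1) (j%:Z - n%:Z == z)%:R * f (j%:Z - n%:Z) = trunc n f z.
Proof.
rewrite /trunc; case: ifPn => [zn|zn].
  have lt : (`|(z + n%:Z)%R| < n.*2.+1)%N by lia.
  have zE : (absz (z + n%:Z))%:Z - n%:Z = z by lia.
  rewrite (bigD1 (Ordinal lt)) //= big1 ?addr0; first by rewrite zE eqxx mul1r.
  move=> j jz; case: eqP => [e|_]; last by rewrite mul0r.
  by case/eqP: jz; apply: val_inj; rewrite /= -e subrK.
apply: big1 => j _; case: eqP => [e|_]; last by rewrite mul0r.
by case/negP: zn; rewrite -e; have := ltn_ord j; move: (nat_of_ord j) => k; lia.
Qed.

Lemma fsec_mul n (f : int -> R) (i : 'I_n.*2.+1) :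
  \sum_j fsec R v n i j * f (j%:Z - n%:Z) = schr v (trunc n f) (i%:Z - n%:Z).
Proof.
rewrite /schr -!sum_box mulr_sumr -!big_split /=; apply: eq_bigr => j _.
rewrite mxE /schr_entry.
move: (i%:Z - n%:Z) (j%:Z - n%:Z) => a b {i j}.
have -> : (a == b + 1) = (b == a - 1) by lia.
rewrite (eq_sym a b).
have [->|ba] := eqVneq b a.
  have -> : (a == a + 1) = false by lia.
  have -> : (a == a - 1) = false by lia.
  by rewrite /=; ring.
have [->|ba1] := eqVneq b (a - 1).
  have -> : (a - 1 == a + 1) = false by lia.
  by rewrite /=; ring.
by case: eqP => /= _; ring.
Qed.

(** The discrete Green kernel: [a] meets the left boundary condition and [b] the right one. Off the
    diagonal the recurrence for [a] or [b] gives 0; on it the jump is the Casoratian, and dividing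
    by [W] makes it 1. *)
Lemma fsec_green n (a b : int -> R) (W : R) : is_sol v a -> is_sol v b ->
  a (- n%:Z - 1) = 0 -> b (n%:Z + 1) = 0 ->
  (forall k, a k * b (k + 1) - a (k + 1) * b k = W) -> W != 0 ->
  fsec R v n \in unitmx /\ invmx (fsec R v n) = \matrix_(i, j)
    ((if (i <= j)%N then a (i%:Z - n%:Z) * b (j%:Z - n%:Z)
      else a (j%:Z - n%:Z) * b (i%:Z - n%:Z)) / W).
Proof.
move=> sa sb a0 b0 abW W0; set G := \matrix_(i, j) _.
pose g (i j : int) := (if i <= j then a i * b j else a j * b i) / W.
suff AG : fsec R v n *m G = 1%:M.
  have [uA _] := mulmx1_unit AG; split=> //.
  by rewrite -[RHS](mulKmx uA) AG mulmx1.
apply/matrixP => i j; rewrite !mxE.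
rewrite (eq_bigr (fun k => fsec R v n i k * g (k%:Z - n%:Z) (j%:Z - n%:Z))); last first.
  by move=> k _; rewrite [G k j]mxE /g lerD2r lez_nat.
rewrite (fsec_mul (fun k => g k (j%:Z - n%:Z))).
have -> : (i == j) = (i%:Z - n%:Z == j%:Z - n%:Z) by rewrite -val_eqE /=; lia.
have : `|i%:Z - n%:Z| <= n%:Z by have := ltn_ord i; move: (nat_of_ord i) => k; lia.
have : `|j%:Z - n%:Z| <= n%:Z by have := ltn_ord j; move: (nat_of_ord j) => k; lia.
move: (i%:Z - n%:Z) (j%:Z - n%:Z) => {}i {}j jn ni.
(* Truncation does not change the kernel at the sites adjacent to the box, where [a] or [b] is zero;
   so the end rows behave like inner ones. *)
have gE k : - n%:Z - 1 <= k <= n%:Z + 1 -> trunc n (g^~ j) k = g k j.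
  move=> kn; rewrite /trunc; case: ifPn => // kn'; rewrite /g.
  have [->|k1] := eqVneq k (- n%:Z - 1).
    have -> : - n%:Z - 1 <= j by lia.
    by rewrite a0 !mul0r.
  have -> : k = n%:Z + 1 by lia.
  have -> : (n%:Z + 1 <= j) = false by lia.
  by rewrite b0 mulr0 mul0r.
rewrite /schr !gE; try lia.
rewrite /g; have [ij|ij|ij] := ltgtP i j.
- have -> : (i + 1 <= j) by lia.
  have -> : (i - 1 <= j) by lia.
  by rewrite /= (sol_next i sa); field.
- have -> : (i + 1 <= j) = false by lia.
  have -> : (if i - 1 <= j then a (i - 1) * b j else a j * b (i - 1)) = a j * b (i - 1).
    by case: ifP => // h; have -> : i - 1 = j by lia.
  by rewrite /= (sol_next i sb); field.
- rewrite -ij.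
  have -> : (i + 1 <= i) = false by lia.
  have -> : (i - 1 <= i) by lia.
  have e : a (i - 1) = - a (i + 1) - (v i)%:~R * a i := sol_prev i sa.
  rewrite /= e; transitivity ((a i * b (i + 1) - a (i + 1) * b i) / W); first by field.
  by rewrite abW divff.
Qed.

End box.

(** * Exponential dichotomy and uniform decay of the section inverses *)

Lemma near_expr_le (R : realType) (r C e : R) : 0 <= r < 1 -> 0 < e ->
  exists N : nat, forall n, (N <= n)%N -> C * r ^+ n <= e.
Proof.
move=> /andP[r0 r1] e0.
have : (fun n => C * r ^+ n) @ \oo --> C * 0.
  by apply: cvgMr; apply: cvg_expr; rewrite ger0_norm.
rewrite mulr0 => /cvgrPdist_le /(_ _ e0) [N _ hN]; exists N => n /hN /=.
by rewrite sub0r normrN => /ler_normlP[].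
Qed.

Lemma box_index (n k : nat) : (k < n.*2.+1)%N ->
  - n%:Z - 1 <= k%:Z - n%:Z <= n%:Z + 1.
Proof. lia. Qed.

Lemma box_width (n : nat) :
  - n%:Z - 1 <= n%:Z + 1 /\ (n <= absz (n%:Z + 1 - (- n%:Z - 1))%R)%N.
Proof. by split; lia. Qed.

Section decay.
Variables (R : realType) (v : int -> int) (K : nat).
Hypotheses (K0 : (0 < K)%N) (vK : forall n, v (n + K%:Z) = v n).

Lemma dichotomy : 2 < `|\tr (@monodromy R v K 0)| ->
  exists (r C w : R) (phi psi : int -> R), [/\ 0 < r < 1, 0 < C & w != 0] /\
    [/\ is_sol v phi, is_sol v psi,
      (forall n, phi n != 0) & (forall n, psi n != 0)] /\
    [/\ forall i j, i <= j -> `|phi j| <= C * r ^+ absz (j - i) * `|phi i|,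
      forall i j, i <= j -> `|psi i| <= C * r ^+ absz (j - i) * `|psi j|,
      forall i, `|psi i * phi i| <= C &
      forall i, psi i * phi (i + 1) - psi (i + 1) * phi i = w].
Proof.
move=> /hyperbolic_roots[l [m [lm lm1 l1]]].
have l0 : l != 0 by apply/negP => /eqP l0; move: lm1; rewrite l0 mul0r; lra.
have mE : m = l^-1 by rewrite -[LHS]mul1r -(mulVf l0) -mulrA lm1 mulr1.
have ml1 : m * l = 1 by rewrite mulrC.
have nlm : l != m.
  apply/negP => /eqP e; have := congr1 Num.norm lm1; rewrite -e normrM normr1.
  by have := normr_ge0 l; nra.
have nl1 : `|l| != 1 by rewrite lt_eqF.
have nm1 : `|m| != 1.
  by rewrite mE normfV invr_eq1.
have [phi [sphi qphi /(eigen_sol_neq0 sphi qphi lm1 nl1) zphi]] := eigen_sol vK lm lm1 nlm.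
have [psi [spsi qpsi /(eigen_sol_neq0 spsi qpsi ml1 nm1) zpsi]] :
    exists psi : int -> R, [/\ is_sol v psi,
      forall n, psi (n + K%:Z) = m * psi n & exists n, psi n != 0].
  by apply: (@eigen_sol _ _ _ vK m l) => //; rewrite 1?addrC// eq_sym.
have lp : 0 < `|l| by rewrite normr_gt0.
(* The decay rate per site: [K] sites together contribute the factor [|l|]. *)
pose r := `|l| `^ (K%:R^-1).
have r0 : 0 < r by exact: powR_gt0.
have rK : r ^+ K = `|l|.
  rewrite -powR_mulrn ?ltW// -powRrM mulVf ?powRr1//.
  by rewrite pnatr_eq0 -lt0n.
have r1 : r < 1.
  rewrite ltNge; apply/negP => r1; have := exprn_ege1 K r1; rewrite rK; lra.
have riK : r^-1 ^+ K = `|m| by rewrite mE normfV exprVn rK.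
have [C1 C10 h1] := quasi_periodic_compare K0 r0 rK zphi qphi.
have ri0 : 0 < r^-1 by rewrite invr_gt0.
have [C2 C20 h2] := quasi_periodic_compare K0 ri0 riK zpsi qpsi.
(* The eigenvalues cancel as [l * m = 1], so the product is periodic and therefore bounded. *)
have prodK n : psi (n + K%:Z) * phi (n + K%:Z) = psi n * phi n.
  by rewrite qphi qpsi; ring: lm1.
have [C3 C30 h3] := periodic_bounded K0 prodK.
exists r, (C1 + C2 + C3), (psi 0 * phi 1 - psi 1 * phi 0), phi, psi.
split; first split=> //.
- by rewrite r0 r1.
- by lra.
(* With a vanishing Casoratian, [psi] would be the multiple [c] of [phi]; comparing the two at [K]
   would give [l = m]. *)
- apply/negP => /eqP w0.
  pose c := psi 0 / phi 0.
  have szero : is_sol v (fun n => 1 * psi n + (- c) * phi n) by exact: sol_lin.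
  have p0 := zphi 0.
  have e0 : 1 * psi 0 + (- c) * phi 0 = 0 by rewrite /c; field.
  have e1 : 1 * psi (0 + 1) + (- c) * phi (0 + 1) = 0.
    by rewrite add0r; apply: (mulIf p0); rewrite mul0r -[RHS]oppr0 -w0 /c; field.
  have := sol_eq0 szero e0 e1 K%:Z.
  have := qphi 0; have := qpsi 0; rewrite add0r => -> ->.
  have -> : 1 * (m * psi 0) + (- c) * (l * phi 0) = (m - l) * psi 0 by rewrite /c; field.
  by move=> /eqP; rewrite mulf_eq0 (negbTE (zpsi 0)) orbF subr_eq0 eq_sym (negbTE nlm).
split; first by split.
have CC (x y : R) : 0 <= x -> 0 <= y -> C1 * x * y <= (C1 + C2 + C3) * x * y
     /\ C2 * x * y <= (C1 + C2 + C3) * x * y.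
  move=> x0 y0; rewrite -!mulrA; have xy := mulr_ge0 x0 y0.
  by split; apply: ler_wpM2r => //; lra.
split.
- move=> i j ij; apply: le_trans (h1 i j) _.
  have -> : r ^ (j - i) = r ^+ absz (j - i).
    by rewrite -[in LHS](gez0_abs (_ : 0 <= j - i)) // subr_ge0.
  by apply: (CC _ _ _ _).1 => //; rewrite exprn_ge0// ltW.
- move=> i j ij; apply: le_trans (h2 j i) _.
  have -> : r^-1 ^ (i - j) = r ^+ absz (j - i).
    by rewrite exprz_inv opprB -[in LHS](gez0_abs (_ : 0 <= j - i)) // subr_ge0.
  by apply: (CC _ _ _ _).2 => //; rewrite exprn_ge0// ltW.
- by move=> i; apply: le_trans (h3 i) _; lra.
- by move=> i; exact: casorati_const.
Qed.

(** The Green kernel is built from [a = psi - al phi], zero at [lo], and [b = phi - be psi], zero at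
    [hi]. Inside the box these are comparable to [psi] and [phi], and their Casoratian
    [w (1 - al be)] stays away from 0 because [al be] is exponentially small in [n]. *)
Lemma fsec_inv_decay : 2 < `|\tr (@monodromy R v K 0)| ->
  exists (r C : R) (N : nat), [/\ 0 < r < 1, 0 <= C &
    forall n, (N <= n)%N -> fsec R v n \in unitmx /\
      forall i j, `|invmx (fsec R v n) i j| <= C * r ^+ absz (i%:Z - j%:Z)].
Proof.
move=> /dichotomy[r [C [w [phi [psi [[r01 C0 w0] [[sphi spsi zphi zpsi]]]]]]]].
move=> [hphi hpsi hpp hw]; have /andP[r0 r1] := r01.
have r01' : 0 <= r < 1 by rewrite ltW.
have rX k : 0 <= r ^+ k by rewrite exprn_ge0// ltW.
have rX1 k : r ^+ k <= 1 by rewrite exprn_ile1 ?ltW.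
have e0 : 0 < 2^-1 :> R by lra.
have [N hN] := near_expr_le (C * C) r01' e0.
have D0 : 0 <= (1 + C * C) ^+ 2 by exact: sqr_ge0.
exists r, ((1 + C * C) ^+ 2 * (C * C) * (2 / `|w|)), N; split=> //.
  have C0' := ltW C0.
  apply: mulr_ge0; last by rewrite mulr_ge0 ?invr_ge0.
  by apply: mulr_ge0 => //; exact: mulr_ge0.
move=> n Nn.
pose lo := - n%:Z - 1; pose hi := n%:Z + 1.
pose al := psi lo / phi lo; pose be := phi hi / psi hi.
pose a k := 1 * psi k + (- al) * phi k; pose b k := 1 * phi k + (- be) * psi k.
have sa : is_sol v a by exact: sol_lin.
have sb : is_sol v b by exact: sol_lin.
have nphi k : 0 < `|phi k| by rewrite normr_gt0.
have npsi k : 0 < `|psi k| by rewrite normr_gt0.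
have a_le k : lo <= k -> `|a k| <= (1 + C * C) * `|psi k|.
  move=> lok; rewrite /a mul1r mulNr mulrDl mul1r.
  apply: le_trans (ler_normB _ _) _; rewrite lerD2l /al !normrM normfV.
  rewrite mulrAC ler_pdivrMr//.
  have -> : C * C * `|psi k| * `|phi lo| = C * `|psi k| * (C * `|phi lo|) by ring.
  apply: ler_pM => //.
  - apply: le_trans (hpsi _ _ lok) _; apply: ler_wpM2r => //.
    by apply: ler_piMr => //; exact: ltW.
  - apply: le_trans (hphi _ _ lok) _; apply: ler_wpM2r => //.
    by apply: ler_piMr => //; exact: ltW.
have b_le k : k <= hi -> `|b k| <= (1 + C * C) * `|phi k|.
  move=> khi; rewrite /b mul1r mulNr mulrDl mul1r.
  apply: le_trans (ler_normB _ _) _; rewrite lerD2l /be !normrM normfV.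
  rewrite mulrAC ler_pdivrMr//.
  have -> : C * C * `|phi k| * `|psi hi| = C * `|phi k| * (C * `|psi hi|) by ring.
  apply: ler_pM => //.
  - apply: le_trans (hphi _ _ khi) _; apply: ler_wpM2r => //.
    by apply: ler_piMr => //; exact: ltW.
  - apply: le_trans (hpsi _ _ khi) _; apply: ler_wpM2r => //.
    by apply: ler_piMr => //; exact: ltW.
have lohi : lo <= hi by exact: (box_width n).1.
(* The product splits into two ratios between opposite ends of the box. Each decays, but the power
   of [r] is kept in one only; [N] was chosen so that [C * C * r ^ n <= 1 / 2]. *)
have albe : `|al * be| <= 2^-1.
  apply: le_trans (hN n Nn).
  have -> : `|al * be| = (`|psi lo| / `|psi hi|) * (`|phi hi| / `|phi lo|).
    by rewrite /al /be !normrM !normfV; ring.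
  rewrite -[r ^+ n]mulr1 [leRHS]mulrACA; apply: ler_pM; rewrite ?divr_ge0//.
  - rewrite ler_pdivrMr//; apply: le_trans (hpsi _ _ lohi) _.
    rewrite ler_wpM2r//; apply: ler_wpM2l; first exact: ltW.
    by apply: ler_wiXn2l; [exact: ltW|exact: ltW|exact: (box_width n).2].
  - rewrite ler_pdivrMr//; apply: le_trans (hphi _ _ lohi) _.
    by rewrite ler_wpM2r//; apply: ler_wpM2l => //; exact: ltW.
pose W := w * (1 - al * be).
have W1 : `|w| / 2 <= `|W|.
  rewrite /W normrM ler_wpM2l//.
  by have := ler_norm (1 - al * be); move: albe => /ler_normlP[]; lra.
have nw : 0 < `|w| by rewrite normr_gt0.
have W0 : W != 0 by rewrite -normr_gt0; apply: lt_le_trans W1; rewrite divr_gt0.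
have abW k : a k * b (k + 1) - a (k + 1) * b k = W.
  by rewrite /W -(hw k) /a /b; ring.
have alo : a lo = 0 by rewrite /a /al; field.
have bhi : b hi = 0 by rewrite /b /be; field.
have [uA iA] := fsec_green sa sb alo bhi abW W0; split=> // i j.
(* [(1 + C * C) ^ 2] comes from [a_le] and [b_le], one [C] from the decay of [phi] between [s] and
   [t], the other from the bound on [psi s * phi s], and [2 / |w|] from [W1]. *)
have key s t : lo <= s -> s <= t -> t <= hi ->
    `|a s * b t / W| <= (1 + C * C) ^+ 2 * (C * C) * (2 / `|w|) * r ^+ absz (t - s).
  move=> los st thi; rewrite normrM normfV.
  have -> : (1 + C * C) ^+ 2 * (C * C) * (2 / `|w|) * r ^+ absz (t - s) =
    ((1 + C * C) ^+ 2 * (C * C) * r ^+ absz (t - s)) * (`|w| / 2)^-1.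
    by rewrite invf_div; ring.
  apply: ler_pM => //.
    rewrite normrM.
    apply: (@le_trans _ _ (((1 + C * C) * `|psi s|) * ((1 + C * C) * `|phi t|))).
      by apply: ler_pM => //; [exact: a_le|exact: b_le].
    have -> : (1 + C * C) * `|psi s| * ((1 + C * C) * `|phi t|) =
      (1 + C * C) ^+ 2 * (`|psi s| * `|phi t|) by ring.
    rewrite -mulrA; apply: ler_wpM2l; first exact: D0.
    apply: (@le_trans _ _ (`|psi s| * (C * r ^+ absz (t - s) * `|phi s|))).
      by apply: ler_wpM2l => //; exact: hphi.
    have -> : `|psi s| * (C * r ^+ absz (t - s) * `|phi s|) =
      C * `|psi s * phi s| * r ^+ absz (t - s) by rewrite normrM; ring.
    apply: ler_wpM2r => //; apply: ler_wpM2l => //; exact: ltW.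
  by rewrite lef_pV2 // posrE ?divr_gt0// normr_gt0.
have /andP[lo_i i_hi] := box_index (ltn_ord i).
have /andP[lo_j j_hi] := box_index (ltn_ord j).
have dist (s t : int) : s - n%:Z - (t - n%:Z) = s - t by rewrite opprB addrA subrK.
rewrite iA mxE; case: ifPn => ij.
- by have := key _ _ lo_i _ j_hi; rewrite dist distnC lerD2r lez_nat; apply.
- have := key _ _ lo_j _ i_hi; rewrite dist lerD2r lez_nat; apply.
  by rewrite ltnW// ltnNge.
Qed.

End decay.

(** * Action of the section inverses on sequences *)

Lemma box_ordE (n : nat) (k : int) : `|k| <= n%:Z ->
  (inord (absz (k + n%:Z)) : 'I_n.*2.+1)%:Z - n%:Z = k.
Proof. by move=> kn; rewrite inordK; lia. Qed.

Lemma ord_boxE (n : nat) (i : 'I_n.*2.+1) : inord (absz (i%:Z - n%:Z + n%:Z)) = i.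
Proof. by rewrite subrK; apply: val_inj; rewrite /= inordK. Qed.

Lemma ord_box_le (n : nat) (i : 'I_n.*2.+1) : `|i%:Z - n%:Z| <= n%:Z.
Proof. by case: i => i /=; lia. Qed.

Section section_inverse.
Variables (R : realType) (v : int -> int) (n : nat).
Hypothesis uA : fsec R v n \in unitmx.
Local Notation A := (fsec R v n).
Implicit Types x z : int -> R.

Lemma schr_fsec_inv x k : `|k| <= n%:Z -> schr v (fsec_inv_op v n x) k = x k.
Proof.
move=> kn; pose i : 'I_n.*2.+1 := inord (absz (k + n%:Z)).
pose f (l : int) := \sum_(j < n.*2.+1) invmx A (inord (absz (l + n%:Z))) j * x (j%:Z - n%:Z).
rewrite -(box_ordE kn) -/i -(fsec_mul _ f) /f.
under eq_bigr => j _ do rewrite ord_boxE mulr_sumr.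
rewrite exchange_big /=.
transitivity (\sum_j (A *m invmx A) i j * x (j%:Z - n%:Z)).
  by apply: eq_bigr => j _; rewrite mxE mulr_suml; apply: eq_bigr => l _; rewrite mulrA.
rewrite mulmxV// (bigD1 i)//= big1 ?addr0; first by rewrite mxE eqxx mul1r.
by move=> j ji; rewrite mxE eq_sym (negbTE ji) mul0r.
Qed.

Lemma fsec_inv_schr z k : `|k| <= n%:Z ->
  fsec_inv_op v n (schr v (trunc n z)) k = z k.
Proof.
move=> kn; rewrite /fsec_inv_op kn; set i := inord _.
under eq_bigr => j _ do rewrite -fsec_mul mulr_sumr.
rewrite exchange_big /=.
transitivity (\sum_j (invmx A *m A) i j * z (j%:Z - n%:Z)).
  by apply: eq_bigr => j _; rewrite mxE mulr_suml; apply: eq_bigr => l _; rewrite mulrA.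
rewrite mulVmx// (bigD1 i)//= big1 ?addr0; first by rewrite mxE eqxx mul1r box_ordE.
by move=> j ji; rewrite mxE eq_sym (negbTE ji) mul0r.
Qed.

(* Truncating [z] to the box only perturbs the equation [H z = x] at the two end
   rows, by the values of [z] just outside. *)
Lemma fsec_inv_boundary x z k : (forall j, `|j| <= n%:Z -> schr v z j = x j) ->
  `|k| <= n%:Z ->
  fsec_inv_op v n x k - z k =
    invmx A (inord (absz (k + n%:Z))) ord_max * z (n%:Z + 1) +
    invmx A (inord (absz (k + n%:Z))) ord0 * z (- n%:Z - 1).
Proof.
move=> zx kn; rewrite -{1}(fsec_inv_schr z kn) /fsec_inv_op kn; set i := inord _.
rewrite -sumrB.
rewrite (eq_bigr (fun j => (if j == ord_max then invmx A i j * z (n%:Z + 1) else 0) +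
   (if j == ord0 then invmx A i j * z (- n%:Z - 1) else 0))); last first.
  move=> j _; rewrite -mulrBr -zx ?ord_box_le// /schr /trunc ord_box_le.
  rewrite -!val_eqE /=.
  have : (j < n.*2.+1)%N by [].
  move: (invmx A i j) => c; move: (nat_of_ord j) => {}j jn.
  have -> : (j == n.*2) = (j%:Z - n%:Z == n%:Z) by lia.
  have -> : (j == 0)%N = (j%:Z - n%:Z == - n%:Z) by lia.
  have : `|j%:Z - n%:Z| <= n%:Z by lia.
  move: (j%:Z - n%:Z) => {jn}j jn.
  have -> : `|j + 1| <= n%:Z = (j != n%:Z) by lia.
  have -> : `|j - 1| <= n%:Z = (j != - n%:Z) by lia.
  transitivity (c * ((if j == n%:Z then z (n%:Z + 1) else 0) +
      (if j == - n%:Z then z (- n%:Z - 1) else 0))); last first.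
    by rewrite mulrDr; congr (_ + _); case: ifP; rewrite ?mulr0.
  have -> : (if j == n%:Z then z (n%:Z + 1) else 0) =
      z (j + 1) - (if j != n%:Z then z (j + 1) else 0).
    by have [->|_] := eqVneq j n%:Z; rewrite /= ?subr0 ?subrr.
  have -> : (if j == - n%:Z then z (- n%:Z - 1) else 0) =
      z (j - 1) - (if j != - n%:Z then z (j - 1) else 0).
    by have [->|_] := eqVneq j (- n%:Z); rewrite /= ?subr0 ?subrr.
  by ring.
by rewrite big_split /= -!big_mkcond /= !big_pred1_eq.
Qed.

End section_inverse.

(** * The limit of the section inverses *)

Lemma cvg_of_tail_dist (R : realType) (a : nat -> R) :
  (forall e : R, 0 < e -> exists n, forall m, (n <= m)%N -> `|a n - a m| <= e) ->
  cvg (a @ \oo).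
Proof.
move=> ha; apply/cauchy_cvgP; apply: cauchy_exP => e e0.
have e20 : 0 < e / 2 by rewrite divr_gt0.
have [n hn] := ha _ e20.
exists (a n); exists n => // m /= nm; rewrite /ball /=.
by apply: le_lt_trans (hn m nm) _; lra.
Qed.

Section limit_operator.
Variables (R : realType) (v : int -> int) (t C : R) (N : nat).
Hypotheses (t01 : 0 < t < 1) (C0 : 0 <= C).
Hypothesis decay : forall n, (N <= n)%N -> fsec R v n \in unitmx /\
  forall i j, `|invmx (fsec R v n) i j| <= C * (t ^+ 2) ^+ absz (i%:Z - j%:Z).
Implicit Types x z : int -> R.

Let t0 : 0 <= t. Proof. by case/andP: t01 => /ltW. Qed.
Let t1 : t <= 1. Proof. by case/andP: t01 => _ /ltW. Qed.
Let tp : 0 < t. Proof. by case/andP: t01. Qed.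
Let t01' : 0 <= t < 1. Proof. by case/andP: t01 => _ ->; rewrite t0. Qed.
Let tX k : 0 <= t ^+ k. Proof. exact: exprn_ge0. Qed.

Let M := C * (2 / (1 - t)).
Let M0 : 0 <= M.
Proof. by rewrite /M mulr_ge0// divr_ge0// subr_ge0. Qed.

(** The rate [t ^ 2] is split: one factor [t ^ |k - j|] weighs [x j] and yields [s], the other is
    summed over [j] and yields [2 / (1 - t)]. *)
Lemma fsec_inv_supdom n x : (N <= n)%N -> supdom t M x (fsec_inv_op v n x).
Proof.
move=> Nn k s xs; have [uA dA] := decay Nn.
have s0 : 0 <= s by apply: le_trans (xs k); rewrite mulr_ge0.
rewrite /fsec_inv_op; case: ifPn => kn; last by rewrite normr0 mulr_ge0.
apply: le_trans (ler_norm_sum _ _ _) _.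
pose e := [seq j%:Z - n%:Z | j <- index_iota 0 n.*2.+1].
have ue : uniq e.
  by rewrite map_inj_uniq ?iota_uniq// => a b /addIr [].
apply: (@le_trans _ _ (\sum_(j < n.*2.+1) C * (s * t ^+ absz (j%:Z - n%:Z - k)%R))); last first.
  rewrite -!mulr_sumr /M -mulrA ler_wpM2l// mulrC ler_wpM2r//.
  rewrite -(big_mkord xpredT (fun j => t ^+ absz (j%:Z - n%:Z - k)%R)).
  rewrite -(big_map (fun j : nat => j%:Z - n%:Z) xpredT (fun i => t ^+ absz (i - k))).
  exact: sum_geometric_int_le.
apply: ler_sum => j _; rewrite normrM.
apply: le_trans (ler_wpM2r (normr_ge0 _) (dA _ j)) _.
have -> : (inord (absz (k + n%:Z)) : 'I_n.*2.+1)%:Z - j%:Z = k - (j%:Z - n%:Z).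
  by rewrite -{2}(box_ordE kn); ring.
have -> : absz (j%:Z - n%:Z - k)%R = absz (k - (j%:Z - n%:Z))%R by rewrite distnC.
rewrite -mulrA ler_wpM2l// exprAC expr2 -mulrA (mulrC s) ler_wpM2l//.
Qed.

Lemma fsec_inv_dist n x z k : (N <= n)%N ->
  (forall j, `|j| <= n%:Z -> schr v z j = x j) -> `|k| <= n%:Z ->
  `|fsec_inv_op v n x k - z k| <= C / t *
    (t ^+ absz (k - (n%:Z + 1))%R * `|z (n%:Z + 1)| +
     t ^+ absz (k - (- n%:Z - 1))%R * `|z (- n%:Z - 1)|).
Proof.
move=> Nn zx kn; have [uA dA] := decay Nn.
rewrite (fsec_inv_boundary uA zx kn) mulrDr.
(* The matrix entries decay with the distance to the last site inside the box, whereas [z] is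
   evaluated one site further; the division by [t] pays for this extra site. *)
have shift a : C * (t ^+ 2) ^+ a <= C / t * t ^+ a.+1.
  rewrite -mulrA ler_wpM2l// [t ^+ a.+1]exprS mulrA mulVf ?gt_eqF// mul1r -exprM.
  by apply: ler_wiXn2l => //; lia.
apply: le_trans (ler_normD _ _) _; apply: lerD; rewrite normrM mulrA ler_wpM2r//.
  apply: le_trans (dA _ _) _; apply: le_trans (shift _) _; rewrite le_eqVlt; apply/orP; left.
  apply/eqP; congr (_ * t ^+ _); rewrite inordK /=; lia.
apply: le_trans (dA _ _) _; apply: le_trans (shift _) _; rewrite le_eqVlt; apply/orP; left.
apply/eqP; congr (_ * t ^+ _); rewrite inordK /=; lia.
Qed.

Let Ct0 : 0 <= C / t. Proof. by rewrite divr_ge0. Qed.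

Lemma fsec_inv_bounded n x (b : R) : (N <= n)%N -> (forall j, `|x j| <= b) ->
  forall k, `|fsec_inv_op v n x k| <= M * b.
Proof.
move=> Nn xb k; apply: (fsec_inv_supdom Nn) => j; apply: le_trans (xb j).
by rewrite ler_piMl// exprn_ile1.
Qed.

Lemma fsec_inv_dist_le n x z k (b : R) : (N <= n)%N ->
  (forall j, `|j| <= n%:Z -> schr v z j = x j) -> `|k| <= n%:Z ->
  `|z (n%:Z + 1)| <= b -> `|z (- n%:Z - 1)| <= b ->
  `|fsec_inv_op v n x k - z k| <= C / t * (2 * b) * t ^+ (n - absz k).
Proof.
move=> Nn zx kn zb zb'; apply: le_trans (fsec_inv_dist Nn zx kn) _.
rewrite -[leRHS]mulrA; apply: ler_wpM2l => //.
have le1 (c : R) m : 0 <= c -> c <= b -> (n - absz k <= m)%N -> t ^+ m * c <= b * t ^+ (n - absz k).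
  move=> c0 cb nm; rewrite mulrC; apply: ler_pM => //.
  exact: ler_wiXn2l.
have -> : 2 * b * t ^+ (n - absz k) = b * t ^+ (n - absz k) + b * t ^+ (n - absz k) by ring.
by apply: lerD; apply: le1 => //; lia.
Qed.

(** Meant for bounded [x], where the limit exists; without convergence [lim] is a default value. *)
Definition limit_inv x k : R := lim (fsec_inv_op v n x k @[n --> \oo]).

(** A Cauchy argument: for [m >= n], the inverse of section [m] applied to [x] solves the equation
    on the box of size [n], and its values next to that box are at most [M * b]. The boundary
    estimate then bounds the difference by a multiple of [t ^ (n - |k|)]. *)
Lemma limit_inv_cvg x (b : R) k : (forall j, `|x j| <= b) ->
  fsec_inv_op v n x k @[n --> \oo] --> limit_inv x k.
Proof.
move=> xb; apply: cvg_of_tail_dist => e e0.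
have [n1 hn1] := near_expr_le (C / t * (2 * (M * b))) t01' e0.
exists (N + absz k + n1)%N => m nm.
have Nn : (N <= N + absz k + n1)%N by lia.
have Nm : (N <= m)%N by lia.
apply: le_trans (hn1 (N + absz k + n1 - absz k)%N _); last by lia.
apply: fsec_inv_dist_le => //; try exact: fsec_inv_bounded.
- by move=> j jn; apply: schr_fsec_inv; [have [] := decay Nm|lia].
- by lia.
Qed.

Lemma limit_inv_supdom x (b : R) : (forall j, `|x j| <= b) ->
  supdom t M x (limit_inv x).
Proof.
move=> xb k s xs; have /cvg_norm h := @limit_inv_cvg x b k xb.
apply: (cvgr_to_le h); exists N => // n /= Nn; exact: fsec_inv_supdom xs.
Qed.

Lemma schr_limit_inv x (b : R) : (forall j, `|x j| <= b) -> schr v (limit_inv x) = x.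
Proof.
move=> xb; apply/funext => k.
have h j := @limit_inv_cvg x b j xb.
have h1 : (fun n => schr v (fsec_inv_op v n x) k) @ \oo --> schr v (limit_inv x) k.
  by apply: cvgD; [exact: cvgD|exact: cvgMr].
apply: (cvg_unique _ h1) => //.
apply: cvg_near_cst; exists (N + absz k)%N => // n /= nn.
by apply: schr_fsec_inv; [have [] := @decay n|]; lia.
Qed.

(** The boundary estimate is applied with [z] equal to [x] itself, which solves the equation with
    right-hand side [schr v x]. *)
Lemma limit_inv_schr x (b : R) : (forall j, `|x j| <= b) -> limit_inv (schr v x) = x.
Proof.
move=> xb; apply/funext => k; apply: cvg_lim => //.
apply/cvgrPdistC_le => e e0.
have [n1 hn1] := near_expr_le (C / t * (2 * b)) t01' e0.
exists (N + absz k + n1)%N => // n /= nn.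
have Nn : (N <= n)%N by lia.
apply: le_trans (hn1 (n - absz k)%N _); last by lia.
by apply: fsec_inv_dist_le => //; lia.
Qed.

End limit_operator.

(** * From decaying section inverses to applicability *)

Lemma supdom_neighbour (R : realType) (x : int -> R) i (s : R) :
  (forall j, 2^-1 ^+ absz (i - j)%R * `|x j| <= s) ->
  [/\ `|x i| <= s, `|x (i + 1)| <= 2 * s & `|x (i - 1)| <= 2 * s].
Proof.
move=> xs; split.
- by have := xs i; rewrite subrr expr0 mul1r.
- have := xs (i + 1).
  have -> : absz (i - (i + 1))%R = 1%N by lia.
  by rewrite expr1; lra.
- have := xs (i - 1).
  have -> : absz (i - (i - 1))%R = 1%N by lia.
  by rewrite expr1; lra.
Qed.

Lemma lpnorm_infty_le (R : realType) (x : int -> R) (e : R) :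
  (forall i, `|x i| <= e) -> (lpnorm +oo%E x <= e%:E)%E.
Proof. by move=> xe; apply: ge_ereal_sup => _ [i _ <-]; rewrite lee_fin. Qed.

Section sufficiency.
Variables (R : realType) (p : \bar R) (v : int -> int) (K : nat).
Hypotheses (p1 : (1 <= p)%E) (K0 : (0 < K)%N) (vK : forall n : int, v (n + K%:Z) = v n).
Implicit Types (x y u : int -> R).

Lemma schr_supdom : exists2 V : R, 0 <= V & forall x, supdom 2^-1 V x (schr v x).
Proof.
have vRK n : (v (n + K%:Z))%:~R = (v n)%:~R :> R by rewrite vK.
have [c c0 vc] := periodic_bounded K0 vRK.
(* Each neighbour contributes [2 * s], because of the weight 1/2 at distance 1, and the potential
   contributes [c * s]. *)
exists (4 + c); first by lra.
move=> x i s /supdom_neighbour[xi xp xm].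
have cx : `|(v i)%:~R * x i| <= c * s by rewrite normrM ler_pM.
rewrite /schr.
have := ler_normD (x (i + 1) + x (i - 1)) ((v i)%:~R * x i).
by have := ler_normD (x (i + 1)) (x (i - 1)); lra.
Qed.

Lemma in_lp_schr x : in_lp p x -> in_lp p (schr v x).
Proof.
move=> xp; have [V V0 hV] := schr_supdom.
by apply: (in_lp_supdom p1 _ V0 xp (hV x)); lra.
Qed.

Lemma FSM_of_hyperbolic : 2 < `|\tr (@monodromy R v K 0)| -> FSM_applicable p v.
Proof.
move=> /(fsec_inv_decay K0 vK)[r [C [N [/andP[r0 r1] C0 decay0]]]].
(* The square root leaves one factor [t] for summation and one for the domination weight. *)
pose t := Num.sqrt r.
have tt : t ^+ 2 = r by rewrite sqr_sqrtr// ltW.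
have tp : 0 < t by rewrite sqrtr_gt0.
have t1 : t < 1.
  by rewrite ltNge; apply/negP => t1; have := exprn_ege1 2 t1; rewrite tt; lra.
have t01 : 0 < t < 1 by rewrite tp.
have t01' : 0 <= t < 1 by rewrite ltW.
have decay n : (N <= n)%N -> fsec R v n \in unitmx /\
    forall i j, `|invmx (fsec R v n) i j| <= C * (t ^+ 2) ^+ absz (i%:Z - j%:Z).
  by rewrite tt; exact: decay0.
pose M := C * (2 / (1 - t)).
have M0 : 0 <= M by rewrite /M mulr_ge0// divr_ge0// subr_ge0 ltW.
pose C' := C / t.
have C'0 : 0 <= C' by rewrite /C' divr_ge0// ltW.
pose B := @limit_inv R v.
have dom x (b : R) : (forall j, `|x j| <= b) -> supdom t M x (B x).
  exact: (limit_inv_supdom t01 C0 decay).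
have HB x (b : R) : (forall j, `|x j| <= b) -> schr v (B x) = x.
  exact: (schr_limit_inv t01 C0 decay).
have dist n x (b : R) k : (N <= n)%N -> (forall j, `|x j| <= b) -> `|k| <= n%:Z ->
    `|fsec_inv_op v n x k - B x k| <= C / t *
    (t ^+ absz (k - (n%:Z + 1))%R * `|B x (n%:Z + 1)| +
     t ^+ absz (k - (- n%:Z - 1))%R * `|B x (- n%:Z - 1)|).
  move=> Nn xb kn; apply: (fsec_inv_dist t01 C0 decay) => // j _.
  by rewrite (HB _ _ xb).
have out n x k : ~~ (`|k| <= n%:Z) -> `|fsec_inv_op v n x k - B x k| = `|B x k|.
  by move=> kn; rewrite /fsec_inv_op (negbTE kn) sub0r normrN.
exists B; split; [|split].
- split; first exact: in_lp_schr.
  split=> [x xp|].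
    have [b _ [_ xb]] := in_lp_bounded p1 xp.
    split; first exact: in_lp_supdom (dom _ _ xb).
    split; first exact: HB xb.
    exact: (limit_inv_schr t01 C0 decay xb).
  exists (M * (2 / (1 - t))) => x xp.
  have [b _ [_ xb]] := in_lp_bounded p1 xp.
  exact: lpnorm_supdom (dom _ _ xb).
- by exists N => // n /= /decay[].
rewrite /fsec_inv_converges; case: eqP => [pE|pE]; last first.
  have [q pq] : exists q, p = q%:E by case: p p1 pE => // q _ _; exists q.
  move=> x xp; have [b _ [_ xb]] := in_lp_bounded p1 xp.
  have Bp : in_lp p (B x) by exact: in_lp_supdom (dom _ _ xb).
  pose z (n : nat) j := if `|j| <= n%:Z then 0 else B x j.
  have zp n : in_lp p (z n).
    apply: (in_lp_supdom p1 (t := 2^-1) (M := 1) _ _ Bp); rewrite ?ler01//; first by lra.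
    move=> i s /supdom_neighbour[Bs _ _]; rewrite mul1r /z; case: ifP => // _.
    by rewrite normr0; apply: le_trans Bs.
  have S0 : 0 <= 2 * C' + 1 by lra.
  (* The error is dominated by the tail [z n] of the limit: inside the box through the two values of
     [B x] next to it, giving [2 * C']; outside, the error is [- B x] itself, giving 1. *)
  have zdom n : (N <= n)%N -> supdom t (2 * C' + 1) (z n) (fun j => fsec_inv_op v n x j - B x j).
    move=> Nn i s zs.
    have s0 : 0 <= s by apply: le_trans (zs i); rewrite mulr_ge0// exprn_ge0// ltW.
    have [ni|ni] := boolP (`|i| <= n%:Z).
      apply: le_trans (dist _ _ _ _ Nn xb ni) _; rewrite -/C'.
      have := zs (n%:Z + 1); have := zs (- n%:Z - 1); rewrite /z.
      have -> : (`|- n%:Z - 1| <= n%:Z) = false by clear; lia.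
      have -> : (`|n%:Z + 1| <= n%:Z) = false by clear; lia.
      move=> /(ler_wpM2l C'0) z1 /(ler_wpM2l C'0) z2.
      by rewrite mulrDr; lra.
    rewrite out//; have := zs i; rewrite subrr expr0 mul1r /z (negbTE ni) => Bs.
    by apply: le_trans Bs _; rewrite mulrDl mul1r lerDr mulr_ge0// mulr_ge0.
  apply: cvge0_near_le => [n|e e0]; first exact: lpnorm_ge0.
  pose c := (2 * C' + 1) * (2 / (1 - t)).
  have c0 : 0 <= c by rewrite mulr_ge0// divr_ge0// subr_ge0 ltW.
  (* Adding 1 keeps the denominator positive even if [c = 0]. *)
  have ec : 0 < e / (c + 1) by rewrite divr_gt0//; lra.
  have q1 : 1 <= q by move: p1; rewrite pq lee_fin.
  have := lpnorm_tail_cvg0 q1; rewrite -pq.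
  move=> /(_ _ Bp) /fine_cvgP[_] /cvgrPdist_le /(_ _ ec) [n0 _ hn0].
  exists (N + n0)%N => // n /= nn.
  have Nn : (N <= n)%N by clear -nn; lia.
  have nn0 : (n0 <= n)%N by clear -nn; lia.
  apply: le_trans (lpnorm_supdom p1 t01' S0 (zp n) (zdom n Nn)) _; rewrite -/c.
  have := hn0 n nn0; rewrite /= sub0r normrN.
  have [m -> [m0 _]] := in_lp_bounded p1 (zp n).
  rewrite -/(z n) /= ger0_norm// -EFinM lee_fin ler_pdivlMr; last by lra.
  by move=> h; apply: le_trans h; rewrite mulrC ler_wpM2l//; lra.
have poo : (1 <= +oo :> \bar R)%E by rewrite leey.
rewrite pE => k e e0.
have [n0 hn0] := near_expr_le ((2 * C' + 1) * M) t01' e0.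
exists (N + k + n0)%N => // n /= nn x xp x1.
have Nn : (N <= n)%N by clear -nn; lia.
have kn : (k <= n)%N by clear -nn; lia.
have e_ge : (2 * C' + 1) * M * t ^+ (n - k) <= e by apply: hn0; clear -nn; lia.
have xb j : `|x j| <= 1.
  by rewrite -lee_fin; apply: le_trans (ler_lpnorm x j poo) x1.
have tle m : (n - k <= m)%N -> t ^+ m <= t ^+ (n - k).
  by move=> ?; apply: ler_wiXn2l => //; exact: ltW.
have tX m : 0 <= t ^+ m by rewrite exprn_ge0// ltW.
have tX1 m : t ^+ m <= 1 by rewrite exprn_ile1 ?ltW.
split; apply: lpnorm_infty_le => i.
(* Sites with [|i| <= k] are at distance at least [n - k] from the boundary sites, where [B x] is at
   most [M]. *)
- rewrite /trunc; case: ifPn => ik; last by rewrite normr0 ltW.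
  have Bb j : `|B x j| <= M.
    rewrite -[leRHS]mulr1; apply: (dom _ _ xb) => l; apply: le_trans (xb l).
    by rewrite ler_piMl.
  have ni : `|i| <= n%:Z by clear -ik kn; lia.
  apply: le_trans (dist _ _ _ _ Nn xb ni) _; rewrite -/C'; apply: le_trans e_ge.
  have h1 : t ^+ absz (i - (n%:Z + 1))%R * `|B x (n%:Z + 1)| <= t ^+ (n - k) * M.
    by apply: ler_pM => //; apply: tle; clear -ik kn; lia.
  have h2 : t ^+ absz (i - (- n%:Z - 1))%R * `|B x (- n%:Z - 1)| <= t ^+ (n - k) * M.
    by apply: ler_pM => //; apply: tle; clear -ik kn; lia.
  have := ler_wpM2l C'0 (lerD h1 h2).
  by have := mulr_ge0 M0 (tX (n - k)%N); lra.
(* Here the smallness comes from the data: [y] lives on [[-k, k]], so [B y] is at most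
   [M * t ^ (n - k)] at all sites from distance [n] on, which covers both the boundary sites and the
   exterior. *)
- pose y := trunc k x.
  have yb j : `|y j| <= 1 by rewrite /y /trunc; case: ifP; rewrite ?normr0.
  have By j : (n <= absz j)%N -> `|B y j| <= M * t ^+ (n - k).
    move=> nj; apply: (dom _ _ yb) => l; rewrite /y /trunc; case: ifPn => lk; last first.
      by rewrite normr0 mulr0.
    rewrite -[leRHS]mulr1; apply: ler_pM => //; apply: tle; clear -nj lk; lia.
  apply: le_trans e_ge.
  have MT : 0 <= M * t ^+ (n - k) by exact: mulr_ge0.
  have [ni|ni] := boolP (`|i| <= n%:Z).
    apply: le_trans (dist _ _ _ _ Nn yb ni) _; rewrite -/C'.
    have h1 : t ^+ absz (i - (n%:Z + 1))%R * `|B y (n%:Z + 1)| <= 1 * (M * t ^+ (n - k)).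
      by apply: ler_pM => //; apply: By; clear; lia.
    have h2 : t ^+ absz (i - (- n%:Z - 1))%R * `|B y (- n%:Z - 1)| <= 1 * (M * t ^+ (n - k)).
      by apply: ler_pM => //; apply: By; clear; lia.
    by have := ler_wpM2l C'0 (lerD h1 h2); lra.
  rewrite out//; apply: le_trans (By i _) _; first by clear -ni; lia.
  by have := mulr_ge0 C'0 MT; lra.
Qed.

End sufficiency.

(** * Growth of solutions when the trace is at most 2 in modulus *)

Section elliptic.
Variables (R : realType) (t : R).
Hypothesis t2 : `|t| <= 2.

(* [w (q+1)^2 - t w (q+1) w q + w q^2] does not depend on [q] and bounds
   [(|w (q+1)| - |w q|)^2]. *)
Lemma elliptic_growth (w : nat -> R) : (forall q, w q.+2 = t * w q.+1 - w q) ->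
  forall q, `|w q| <= (q%:R + 1) * (`|w 0%N| + `|w 1%N|).
Proof.
move=> wrec; set s := `|w 0%N| + `|w 1%N|.
have s0 : 0 <= s by exact: addr_ge0.
pose Q q := w q.+1 ^+ 2 - t * w q.+1 * w q + w q ^+ 2.
have QE q : Q q = Q 0%N by elim: q => // q <-; rewrite /Q wrec; ring.
have cross q : `|t * w q.+1 * w q| <= 2 * `|w q.+1| * `|w q|.
  by rewrite !normrM; do 2 apply: ler_wpM2r => //.
have Qs : Q 0%N <= s ^+ 2.
  have := ler_norm (- (t * w 1%N * w 0%N)); rewrite normrN => /le_trans/(_ (cross 0%N)).
  rewrite /Q /s -[w 1%N ^+ 2]real_normK ?num_real// -[w 0%N ^+ 2]real_normK ?num_real//.
  by move: `|w 0%N| `|w 1%N| => a b; lra.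
have step q : `|w q.+1| <= `|w q| + s.
  have h : (`|w q.+1| - `|w q|) ^+ 2 <= s ^+ 2.
    apply: le_trans Qs; rewrite -(QE q).
    have := le_trans (ler_norm (t * w q.+1 * w q)) (cross q).
    rewrite /Q -[w q.+1 ^+ 2]real_normK ?num_real// -[w q ^+ 2]real_normK ?num_real//.
    by move: `|w q| `|w q.+1| => a b; lra.
  rewrite addrC -lerBlDr; apply: le_trans (ler_norm _) _.
  by rewrite -ler_sqr ?nnegrE// real_normK ?num_real.
elim=> [|q IH]; first by rewrite add0r mul1r /s lerDl.
by apply: le_trans (step q) _; rewrite -natr1; lra.
Qed.

(** The growth bound is applied along each residue class modulo [K]; the constant adds the initial
    data of all classes. *)
Lemma elliptic_growth_half (K : nat) (u : int -> R) : (0 < K)%N ->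
  (forall n, u (n + K%:Z + K%:Z) = t * u (n + K%:Z) - u n) ->
  exists2 A : R, 0 <= A & forall n : nat, `|u n%:Z| <= (n%:R + 1) * A.
Proof.
move=> K0 urec; exists (\sum_(i < K) (`|u i%:Z| + `|u (i%:Z + K%:Z)|)).
  by apply: sumr_ge0 => i _; exact: addr_ge0.
move=> n.
have rlt : (n %% K < K)%N by rewrite ltn_pmod.
pose w q := u ((n %% K)%N%:Z + q%:Z * K%:Z).
have wrec q : w q.+2 = t * w q.+1 - w q.
  have e j : (n %% K)%N%:Z + j.+1%:Z * K%:Z = (n %% K)%N%:Z + j%:Z * K%:Z + K%:Z.
    by rewrite intS; ring.
  by rewrite /w !e urec.
have := elliptic_growth wrec (n %/ K)%N; rewrite /w mul0r addr0 mul1r.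
have -> : (n %% K)%N%:Z + (n %/ K)%N%:Z * K%:Z = n%:Z.
  by rewrite -PoszM -PoszD addnC -divn_eq.
move=> /le_trans; apply; apply: ler_pM => //.
- by rewrite lerD2r ler_nat leq_div.
- by rewrite (bigD1 (Ordinal rlt))//= lerDl; apply: sumr_ge0 => i _; exact: addr_ge0.
Qed.

(** The recurrence is invariant under reflection, so negative indices reduce to [u (- n)]. *)
Lemma elliptic_growth_int (K : nat) (u : int -> R) : (0 < K)%N ->
  (forall n, u (n + K%:Z + K%:Z) = t * u (n + K%:Z) - u n) ->
  exists2 A : R, 0 <= A & forall n : int, `|u n| <= ((absz n)%:R + 1) * A.
Proof.
move=> K0 urec; have [A A0 hA] := elliptic_growth_half K0 urec.
have [|B B0 hB] := @elliptic_growth_half K (fun n => u (- n)) K0.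
  move=> n; have := urec (- (n + K%:Z + K%:Z)).
  have -> : - (n + K%:Z + K%:Z) + K%:Z = - (n + K%:Z) by ring.
  have -> : - (n + K%:Z) + K%:Z = - n by ring.
  by lra.
exists (A + B) => [|n]; first exact: addr_ge0.
have m0 : 0 <= (absz n)%:R + 1 :> R by rewrite addr_ge0.
rewrite mulrDr; have := mulr_ge0 m0 A0; have := mulr_ge0 m0 B0.
case: (intP n) m0 => [|k|k] m0.
- by have := hA 0%N; rewrite /=; lra.
- by have := hA k.+1; rewrite /=; lra.
- by have := hB k.+1; rewrite /=; lra.
Qed.

End elliptic.

(** Bernoulli's inequality; it lets an exponential weight absorb linear growth. *)
Lemma succ_le_geometric (R : realType) (e : R) (n : nat) : 0 < e <= 1 ->
  e * (n%:R + 1) <= (1 + e) ^+ n.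
Proof.
move=> /andP[e0 e1].
suff h : 1 + e * n%:R <= (1 + e) ^+ n by lra.
elim: n => [|n IH]; first by rewrite expr0 mulr0 addr0.
rewrite exprS -natr1.
apply: (@le_trans _ _ ((1 + e) * (1 + e * n%:R))); last by apply: ler_wpM2l => //; lra.
by have := mulr_ge0 (mulr_ge0 (ltW e0) (ltW e0)) (ler0n R n); lra.
Qed.

(** * Damped solutions contradict a bounded inverse *)

Section necessity.
Variables (R : realType) (p : \bar R) (v : int -> int) (K : nat).
Hypotheses (p1 : (1 <= p)%E) (K0 : (0 < K)%N) (vK : forall n : int, v (n + K%:Z) = v n).

(* As [d -> 1] the damped solution becomes an approximate null vector. *)
Lemma damped_supdom (u : int -> R) (d : R) : 0 < d <= 1 -> is_sol v u ->
  let x i := u i * d ^+ absz i in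
  supdom 2^-1 (4 * (d^-1 - 1)) x (schr v x).
Proof.
move=> /andP[d0 d1] su x i s /supdom_neighbour[_ xp xm].
have d1' : 0 <= d^-1 - 1 by rewrite subr_ge0 invf_ge1.
have near (j : int) : absz j = (absz i).+1 \/ absz i = (absz j).+1 ->
    `|x j - u j * d ^+ absz i| <= (d^-1 - 1) * `|x j|.
  have dX k : 0 < d ^+ k by exact: exprn_gt0.
  move=> h; rewrite /x -mulrBr normrM normrM mulrCA; apply: ler_wpM2l => //.
  rewrite [`|d ^+ absz j|]gtr0_norm//.
  (* Moving away from the origin gives equality; moving towards it, the defect is [1 - d], which is
     at most [d^-1 - 1]. *)
  case: h => ->.
    rewrite [in leRHS]exprS exprS mulrBl mul1r mulrA mulVf ?gt_eqF// mul1r.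
    rewrite -{2}[d ^+ absz i]mul1r -mulrBl normrM (gtr0_norm (dX _)) ler0_norm; last by lra.
    by lra.
  rewrite exprS -{1}[d ^+ absz j]mul1r -mulrBl normrM (gtr0_norm (dX _)).
  apply: ler_wpM2r; first exact: ltW.
  rewrite ger0_norm; last by lra.
  have -> : d^-1 - 1 = (1 - d) * d^-1 by field; rewrite gt_eqF.
  by apply: ler_peMr; [lra|rewrite invf_ge1].
(* Subtracting [d ^ |i|] times the equation for [u] at [i] cancels the potential term. *)
have -> : schr v x i = (x (i + 1) - u (i + 1) * d ^+ absz i) +
    (x (i - 1) - u (i - 1) * d ^+ absz i).
  by rewrite /schr /x (sol_next i su); ring.
apply: le_trans (ler_normD _ _) _.
have h1 : `|x (i + 1) - u (i + 1) * d ^+ absz i| <= (d^-1 - 1) * (2 * s).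
  by apply: le_trans (near _ _) _; [clear; lia|apply: ler_wpM2l].
have h2 : `|x (i - 1) - u (i - 1) * d ^+ absz i| <= (d^-1 - 1) * (2 * s).
  by apply: le_trans (near _ _) _; [clear; lia|apply: ler_wpM2l].
by lra.
Qed.

(** If the trace were at most 2 in modulus, a damped solution [x] would satisfy
    [||x|| <= C ||H x|| <= (48 / 100) ||x||], although [|x 0| = 1]. *)
Lemma hyperbolic_of_FSM : FSM_applicable p v -> 2 < `|\tr (@monodromy R v K 0)|.
Proof.
move=> [B [[Hp [Bp [C hC]]] _]]; rewrite ltNge; apply/negP => T2.
pose u := @sol_of R v 1 0; have su : is_sol v u := sol_ofP _ _ _.
have [A A0 uA] := elliptic_growth_int T2 K0 (fun n => sol_trace vK n su).
pose c := 1 + `|C|; have c1 : 1 <= c by rewrite lerDl.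
have Cc : C <= c by rewrite /c; have := ler_norm C; lra.
(* with [d = (1 + e) ^ -2] the damping defect [d^-1 - 1] is at most [3 e] *)
pose e := (100 * c)^-1.
have e0 : 0 < e by rewrite invr_gt0; lra.
have ce : c * e = 100^-1 by rewrite /e invfM mulrCA mulfV ?mulr1// gt_eqF//; lra.
have e1 : e <= 1 by nra.
pose t := (1 + e)^-1.
have ep : 0 < 1 + e by lra.
have t0 : 0 < t by rewrite invr_gt0.
have t1 : t < 1 by rewrite invf_lt1//; lra.
pose d := t ^+ 2.
have d0 : 0 < d by exact: exprn_gt0.
have d1 : d <= 1 by apply: exprn_ile1; exact: ltW.
have dE : d^-1 - 1 <= 3 * e.
  by rewrite /d /t exprVn invrK; nra.
pose x i := u i * d ^+ absz i.
have xdom : supdom 2^-1 (4 * (d^-1 - 1)) x (schr v x).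
  by apply: damped_supdom => //; rewrite d0.
have xp : in_lp p x.
  have t01 : 0 <= t < 1 by rewrite ltW.
  (* [d ^ |i|] is [t ^ |i|] twice: one factor absorbs the linear growth of [u], the other is the
     geometric bound. *)
  apply: (@in_lp_geometric _ p t (A / e)) => //; first by rewrite divr_ge0// ltW.
  move=> i; rewrite /x normrM [`|d ^+ _|]gtr0_norm ?exprn_gt0// /d -exprM mulnC exprM expr2.
  rewrite mulrA; apply: ler_wpM2r; first by rewrite exprn_ge0// ltW.
  apply: le_trans (ler_wpM2r _ (uA i)) _; first by rewrite exprn_ge0// ltW.
  rewrite ler_pdivlMr//.
  have := succ_le_geometric (absz i) (_ : 0 < e <= 1); rewrite e0 e1 => /(_ isT) h.
  rewrite /t exprVn.
  have -> : ((absz i)%:R + 1) * A / (1 + e) ^+ absz i * e =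
    A * (e * ((absz i)%:R + 1) / (1 + e) ^+ absz i) by ring.
  by rewrite ler_piMr// ler_pdivrMr ?exprn_gt0// mul1r.
have Mx0 : 0 <= 4 * (d^-1 - 1) by rewrite mulr_ge0// subr_ge0 invf_ge1.
have half : 0 <= (2^-1 : R) < 1 by lra.
have n1 := lpnorm_supdom p1 half Mx0 xp xdom.
have [_ [_ BHx]] := Bp _ xp.
have n2 := hC _ (Hp _ xp); rewrite BHx in n2.
have [m mE [m0 mx]] := in_lp_bounded p1 xp.
have [m' mE' [m'0 _]] := in_lp_bounded p1 (Hp _ xp).
move: n1 n2; rewrite mE mE' -!EFinM !lee_fin => n1 n2.
have m1 : 1 <= m by have := mx 0; rewrite /x expr0 mulr1 /u /= normr1.
(* [48 = 4 * 3 * 4]: the defect constant [4 * (d^-1 - 1)], the bound [3 * e], and the factor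
   [2 / (1 - 1 / 2)] of the norm estimate. *)
have n3 : m' <= 48 * e * m.
  apply: le_trans n1 _; apply: ler_wpM2r => //.
  have -> : 2 / (1 - 2^-1) = 4 :> R by field.
  by lra.
have n4 : m <= c * (48 * e * m).
  apply: le_trans n2 _; apply: le_trans (ler_wpM2r m'0 Cc) _.
  by apply: ler_wpM2l n3; lra.
have : c * (48 * e * m) = 48 * 100^-1 * m by rewrite -ce; ring.
by lra.
Qed.

End necessity.

Theorem theorem3p14 (R : realType) (p : \bar R) (v : int -> int) (K : nat) :
  (1 <= p)%E -> (0 < K)%N -> (forall n : int, v (n + K%:Z) = v n) ->
  (FSM_applicable p v <-> 2 < `|\tr (@monodromy R v K 0)|).
Proof.
move=> p1 K0 vK; split; first exact: hyperbolic_of_FSM.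
exact: FSM_of_hyperbolic.
Qed.
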